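(* Let $1<\mu\leq 2$ and let $f:(-1,1)\times(0,\infty)\rightarrow\mathbb{R}$ be continuous ($f$ is allowed to be singular at $t=-1$, $t=1$ and $x=0$). Assume the following two conditions. (A1) For every $x>0$, $f(t,x)=f(-t,x)$ for all $t\in(-1,1)$. There exist $q\in C(-1,1)$, $u\in C(0,\infty)$ decreasing, and $v\in C[0,\infty)$ increasing such that $$|f(t,x)|\leq q(t)\,(u(x)+v(x)),\qquad t\in(-1,1),\ x\in(0,\infty),$$ $$\int_{-1}^{1}(1-|t|)^{\mu-1}q(t)\,dt<\infty,\qquad\text{and}\qquad \int_{-1}^{1}(1-|t|)^{\mu-1}q(t)\,u\left(c\,(1-|t|^{\mu})\right)dt<\infty\ \text{ for } c>0.$$ (A2) There exist a parameter $\gamma_{r}$, positive and decreasing for $r>0$, and a constant $R>\frac{2\gamma_{R}}{\Gamma(\mu+1)}$ such that $f(t,x)\geq\gamma_{R}$ for all $t\in(-1,1)$ and $x\in(0,R]$. Moreover, $$\frac{R}{\chi_{R}\left(1+\frac{v(R)}{u(R)}\right)}>1,\qquad\text{where}\qquad \chi_{r}=\int_{-1}^{1}(1-|t|)^{\mu-1}q(t)\,u\left(\frac{2\gamma_{r}(1-|t|^{\mu})}{\Gamma(\mu+1)}\right)dt.$$ Then the Caputo fractional singular boundary value problem $${}^{C}D_{0}^{\mu}x(t)+f(t,x(t))=0,\quad t\in(-1,1),\qquad x(\pm1)=x'(0^{\pm})=0,$$ has a symmetric positive solution.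
   Context: Caputo derivatives. For $n\in\mathbb{N}$ and $\mu\in(n-1,n]$ (here $n=2$), the Caputo fractional left derivative of order $\mu$ based at $0$ is $${}^{C}D_{0^{+}}^{\mu}x(t)=\frac{1}{\Gamma(n-\mu)}\int_{0}^{t}\frac{x^{(n)}(\tau)}{(t-\tau)^{\mu-n+1}}\,d\tau,\qquad t\ge 0,$$ and the Caputo fractional right derivative of order $\mu$ based at $0$ is $${}^{C}D_{0^{-}}^{\mu}x(t)=\frac{(-1)^{n}}{\Gamma(n-\mu)}\int_{t}^{0}\frac{x^{(n)}(\tau)}{(\tau-t)^{\mu-n+1}}\,d\tau,\qquad t\le 0.$$ When $\mu=n$ these are understood, by the usual convention, as $x^{(n)}(t)$ and $(-1)^n x^{(n)}(t)$ respectively. In the boundary value problem, ${}^{C}D_{0}^{\mu}x(t)={}^{C}D_{0^{+}}^{\mu}x(t)$ for $t\geq0$ and ${}^{C}D_{0}^{\mu}x(t)={}^{C}D_{0^{-}}^{\mu}x(t)$ for $t\leq0$. The notation $x'(0^{\pm})=0$ means that $x'(0^{+})=0$ and $x'(0^{-})=0$; $x(\pm1)=0$ means $x(1)=0$ and $x(-1)=0$. Symmetric positive solution. A symmetric positive solution of the boundary value problem is a function $x\in C[-1,1]$ that satisfies the boundary value problem (equation and boundary conditions), with $x(t)=x(-t)$ for $t\in[-1,1]$ and $x(t)>0$ for $t\in(-1,1)$.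
   Formalization: Adds u(R)>0 and v(R)≥0 (shifting u,v by constants makes (A2) too weak otherwise), and reads the Caputo derivative as d/dt of the fractional integral of x'−x'(0), since the printed formula is 0 at t=0 when μ<2. *)

(* Defs.v *)
From HB Require Import structures.
From mathcomp Require Import all_boot all_order all_algebra.
From mathcomp Require Import all_classical all_reals all_analysis.

Set Implicit Arguments.
Unset Strict Implicit.
Unset Printing Implicit Defensive.

Import Order.TTheory GRing.Theory Num.Theory.
Import numFieldNormedType.Exports.

Local Open Scope classical_set_scope.
Local Open Scope ring_scope.

(* Euler's integral; only used for s > 0, where it converges. *)
Definition Gamma {R : realType} (s : R) : R :=
  \int[lebesgue_measure]_(z in `]0, +oo[) (z `^ (s - 1) * expR (- z)).

(* Derivative relative to a set D: two-sided at interior points of D,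
   one-sided at an endpoint of D that belongs to D. *)
Definition diff_quotient {R : realType} (g : R -> R) (t s : R) : R :=
  (g s - g t) / (s - t).

Definition derivable_in {R : realType} (D : set R) (g : R -> R) (t : R) : Prop :=
  cvg (diff_quotient g t s @[s --> within D t^']).

Definition derive_in {R : realType} (D : set R) (g : R -> R) (t : R) : R :=
  lim (diff_quotient g t s @[s --> within D t^']).

Definition C1_in {R : realType} (D : set R) (g : R -> R) : Prop :=
  (forall t, D t -> derivable_in D g t) /\
  {within D, continuous (derive_in D g)}.

(* Caputo derivatives of order 1 < mu <= 2 based at 0, on [0, 1) and (-1, 0].
   In
     (Gamma (2 - mu))^-1 * int_0^t x''(tau) (t - tau)^(1 - mu) dtau
   x'' is read as the distributional derivative of the continuous function
   x' (extended by x'(0) to the left of 0): one derivative is taken outside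
   the integral,
     d/dt [(Gamma (2 - mu))^-1 *
           int_0^t (x'(tau) - x'(0)) (t - tau)^(1 - mu) dtau].
   Both expressions agree at t > 0 as soon as x is C^2 on [0, 1).  The first
   one, with a pointwise x'', would be 0 at t = 0 and would in general be
   undefined for a function x whose Caputo derivative is merely continuous.
   At t = 0 the outer derivative is one-sided.  The reflection that maps the
   derivative at 0- to the one at 0+ gives the sign (-1)^2, no extra sign
   coming from the outer d/dt.  For mu = 2 both derivatives are x''. *)
Definition caputo_left_primitive {R : realType} (mu : R) (x : R -> R) (t : R) : R :=
  let dx := derive_in `[0, 1[ x in
  if mu == 2 then dx t - dx 0
  else (Gamma (2 - mu))^-1 *
       \int[lebesgue_measure]_(tau in `[0, t])
         ((dx tau - dx 0) / (t - tau) `^ (mu - 1)).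

Definition caputo_right_primitive {R : realType} (mu : R) (x : R -> R) (t : R) : R :=
  let dx := derive_in `]-1, 0] x in
  if mu == 2 then (-1) ^+ 2 * (dx t - dx 0)
  else (-1) ^+ 2 / Gamma (2 - mu) *
       \int[lebesgue_measure]_(tau in `[t, 0])
         ((dx tau - dx 0) / (tau - t) `^ (mu - 1)).

Definition caputo_left_exists {R : realType} (mu : R) (x : R -> R) (t : R) : Prop :=
  C1_in `[0, 1[ x /\ derivable_in `[0, 1[ (caputo_left_primitive mu x) t.

Definition caputo_right_exists {R : realType} (mu : R) (x : R -> R) (t : R) : Prop :=
  C1_in `]-1, 0] x /\ derivable_in `]-1, 0] (caputo_right_primitive mu x) t.

Definition caputo_left {R : realType} (mu : R) (x : R -> R) (t : R) : R :=
  derive_in `[0, 1[ (caputo_left_primitive mu x) t.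

Definition caputo_right {R : realType} (mu : R) (x : R -> R) (t : R) : R :=
  derive_in `]-1, 0] (caputo_right_primitive mu x) t.

(* At t = 0 the equation is required for both derivatives. *)
Definition is_bvp_solution {R : realType} (mu : R) (f : R -> R -> R)
    (x : R -> R) : Prop :=
  (forall t : R, 0 <= t -> t < 1 ->
     caputo_left_exists mu x t /\ caputo_left mu x t + f t (x t) = 0) /\
  (forall t : R, -1 < t -> t <= 0 ->
     caputo_right_exists mu x t /\ caputo_right mu x t + f t (x t) = 0) /\
  x 1 = 0 /\ x (-1) = 0 /\
  derive1 x s @[s --> 0^'+] --> (0 : R) /\
  derive1 x s @[s --> 0^'-] --> (0 : R).

Definition is_symmetric_positive_solution {R : realType} (mu : R)
    (f : R -> R -> R) (x : R -> R) : Prop :=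
  {within `[-1, 1], continuous x} /\
  is_bvp_solution mu f x /\
  (forall t : R, -1 <= t <= 1 -> x t = x (- t)) /\
  (forall t : R, -1 < t < 1 -> 0 < x t).

Definition chi {R : realType} (mu : R) (q u gamma : R -> R) (r : R) : R :=
  \int[lebesgue_measure]_(t in `]-1, 1[)
    ((1 - `|t|) `^ (mu - 1) * q t *
     u (2 * gamma r * (1 - `|t| `^ mu) / Gamma (mu + 1))).

(* Main.v *)
Require Import Defs.
From mathcomp Require Import all_boot all_order all_algebra.
From mathcomp Require Import all_classical all_reals all_analysis.
From mathcomp Require Import measurable_realfun ring lra.

Import Order.TTheory GRing.Theory Num.Theory.
Import numFieldNormedType.Exports.

Local Open Scope classical_set_scope.
Local Open Scope ring_scope.

(* Write p = mu - 1 and G = Gamma mu.  An even solution satisfies, on [0, 1],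
     x t = m - (1 / G) int_0^t (t - s)^p f(s, x s) ds   with x 1 = 0.
   No fixed point theorem is needed.  Truncate x from below by
   floor t = gamma rho / Gamma (mu + 1) (1 - t^mu) and from above by rho, and
   replace x s by x (s - h): the delayed equation is solved by iteration for
   every m.  Its solution is positive at 1 for m = rho and nonpositive for
   m = 0, so some m in [0, rho] makes it vanish at 1; then it lies between
   floor and rho.  As h -> 0, a cluster point for pointwise convergence is, by a
   modulus of continuity on each [0, T] with T < 1 and dominated convergence,
   a solution.

   Positivity for m = rho is an a priori estimate.  Put d = 2 gamma rho /
   Gamma (mu + 1), w s = (1 - s)^p / G and F t = int_0^t w f, so that
   rho - y t <= t^p F t.  With the phase z = (F - (rho - d)) / d one gets
   y t >= d (1 - max (z t) t ^ mu), hence, f being even, f <= Q U(max z t)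
   with Q >= gamma rho and U s = u (d (1 - s^mu)) / u rho >= 1 increasing.
   If y 1 <= 0, then z increases from a negative value to 1, and this forces
   C = int w Q U to be at least about 5/6 rho.  But C is at most
   chi (1 + v rho / u rho) / (2 G) < 5/6 rho, since Gamma mu >= 3/5.

   For the regularity, x' is minus a Riemann-Liouville integral of order p, and
   the semigroup law turns the Caputo primitive into - int_0^t f(s, x s) ds. *)

(** * Beta and Gamma integrals *)

(** The obstacle is a factor 2: [f >= gamma rho] alone yields only the profile [floor], half of the
    profile [d (1 - |t|^mu)] at which [chi] evaluates [u]. So [chi] does not dominate the integral
    of [f] along a truncated solution, and the phase has to measure how far the solution falls below
    the profile of [chi]. The loss is paid by the lower bound [gamma rho] on the dominator, through
    an arithmetic-geometric inequality, and leaves the barrier value [(4/3 - 1/2) d = 5/6 d] at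
    worst. On the other side, folding [[-1, 1]] onto [[0, 1]] produces the 2 in [2 G], and
    [2 G >= 6/5] is what makes the two constants meet at 5/6. The delay is there because [f] is
    merely continuous in [x]: the undelayed equation may have several solutions for one [m], and
    then no continuous dependence on [m]. The delayed one is determined by finitely many iterations,
    each continuous in [m], so the intermediate value theorem applies. *)

Lemma measurable_affine {R : realType} (c b : R) :
  measurable_fun setT ((fun x => c * x + b) : measurableTypeR R -> measurableTypeR R).
Proof. by apply: measurable_funD => //; exact: measurable_funM. Qed.

Definition affine_image_measure {R : realType} (c b : R) (c0 : 0 < c) :
  {measure set (measurableTypeR R) -> \bar R} :=
  mscale (NngNum (ltW c0))
    (measure_function_pushforward__canonical__measure_function_Measure
       (@lebesgue_measure R) (measurable_affine c b)).

(** Agreement on half-open intervals determines the measure; this gives affine changes of variable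
    for all nonnegative measurable integrands, singular ones included. *)
Lemma lebesgue_measure_affine {R : realType} (c b : R) (c0 : 0 < c)
    (A : set (measurableTypeR R)) :
  measurable A -> lebesgue_measure A = affine_image_measure c b c0 A.
Proof.
move=> mA; apply: lebesgue_measure_unique => // _ [[a d]] _ <-.
rewrite [RHS](_ : _ = (c%:E * lebesgue_measure [set` `]((a - b) / c)%R, ((d - b) / c)%R]])%E); last first.
  congr (_ * lebesgue_measure _)%E.
  apply/seteqP; split=> x /=; rewrite !in_itv/= ltr_pdivrMr// ler_pdivlMr// ltrBlDr lerBrDr;
  by rewrite [x * c]mulrC.
rewrite !lebesgue_measure_itv/= !lte_fin ltr_pM2r ?invr_gt0// ltrD2r.
case: ifPn => _; rewrite ?mule0//.
by rewrite -!EFinD -EFinM; congr EFin; field; exact: lt0r_neq0.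
Qed.

Lemma ge0_integral_affine {R : realType} (c b : R) (h : R -> \bar R) :
  0 < c -> measurable_fun setT h -> (forall x, 0 <= h x)%E ->
  (\int[lebesgue_measure]_x h x =
   c%:E * \int[lebesgue_measure]_x h (c * x + b)%R)%E.
Proof.
move=> c0 mh h0.
transitivity (\int[affine_image_measure c b c0]_x h x)%E.
  by apply: eq_measure_integral => A mA _; exact: lebesgue_measure_affine.
rewrite ge0_integral_mscale//= ge0_integral_pushforward//.
exact: measurable_affine.
Qed.

Lemma ge0_integral_opp {R : realType} (h : R -> \bar R) :
  measurable_fun setT h -> (forall x, 0 <= h x)%E ->
  (\int[lebesgue_measure]_x h x = \int[lebesgue_measure]_x h (- x)%R)%E.
Proof.
move=> mh h0.
rewrite -(preimage_setT (-%R : measurableTypeR R -> measurableTypeR R)).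
rewrite -(@ge0_integral_pushforward _ _ _ _ _ _ _ lebesgue_measure setT)//=.
by apply: eq_measure_integral => //= A mA _; exact/esym/lebesgue_measureN.
Qed.

Lemma ge0_integral_subl {R : realType} (t : R) (h : R -> \bar R) :
  measurable_fun setT h -> (forall x, 0 <= h x)%E ->
  (\int[lebesgue_measure]_x h (t - x)%R = \int[lebesgue_measure]_x h x)%E.
Proof.
move=> mh h0; rewrite (@ge0_integral_affine _ 1 t h)// mul1e.
rewrite [RHS]ge0_integral_opp//.
  by apply: eq_integral => x _; rewrite mul1r addrC.
by apply: measurableT_comp => //; exact: measurable_affine.
Qed.

(** Riemann-Liouville kernel cut off to positive arguments: convolutions become integrals over the
    whole line, so shifts and scalings move no bounds. The cut is explicit because [powR] does not
    vanish at negative arguments. [kern 1] is the indicator of [x > 0]. *)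
Definition kern {R : realType} (a x : R) : R := if 0 < x then x `^ (a - 1) else 0.

Section kern.
Context {R : realType}.
Notation mu := (@lebesgue_measure R).
Implicit Types a b t x s : R.

Lemma kern_ge0 a x : 0 <= kern a x.
Proof. by rewrite /kern; case: ifP => // _; exact: powR_ge0. Qed.

Lemma kern_le0 a x : x <= 0 -> kern a x = 0.
Proof. by move=> x0; rewrite /kern ltNge x0. Qed.

Lemma kernE a x : 0 < x -> kern a x = x `^ (a - 1).
Proof. by rewrite /kern => ->. Qed.

Lemma measurable_kern a : measurable_fun setT (kern a).
Proof.
apply: measurable_fun_ifT => //=.
- exact: measurable_fun_ltr.
Qed.

Lemma kernZ a c x : 0 < c -> kern a (c * x) = c `^ (a - 1) * kern a x.
Proof.
move=> c0; rewrite /kern pmulr_rgt0//; case: ifP => [x0|]; last by rewrite mulr0.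
by rewrite powRM// ltW.
Qed.

End kern.

Section beta_gamma.
Context {R : realType}.
Notation mu := (@lebesgue_measure R).
Implicit Types a b t x s : R.
Local Open Scope ereal_scope.

(** Extended-real values let Tonelli's theorem give the Beta-Gamma identities before any convergence
    is known; finiteness is read off from them later. *)
Definition ebeta a b : \bar R := \int[mu]_s (kern a (1 - s) * kern b s)%:E.

Definition egamma a : \bar R := \int[mu]_z (kern a z * expR (- z))%:E.

Lemma measurable_kernB a t : measurable_fun setT (fun s : R => kern a (t - s)).
Proof. by apply: measurableT_comp (measurable_kern a) _; exact: measurable_funB. Qed.

(** Scaling by [t] multiplies the kernels by [t ^ (a - 1)] and [t ^ (b - 1)] and the measure by [t],
    which leaves [t ^ (a + b - 1)]. *)
Lemma integral_kern_conv a b t :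
  \int[mu]_s (kern a (t - s) * kern b s)%:E = ebeta a b * (kern (a + b) t)%:E.
Proof.
have [t0|t0] := leP t 0%R.
  rewrite (kern_le0 _ _ t0) mule0; apply: integral0_eq => s _.
  have [s0|s0] := leP s 0%R; first by rewrite (kern_le0 b _ s0) mulr0.
  by rewrite kern_le0 ?mul0r// subr_le0 (le_trans t0)// ltW.
rewrite (@ge0_integral_affine _ t 0%R)//; last 2 first.
- apply/measurable_EFinP; apply: measurable_funM; last exact: measurable_kern.
  exact: measurable_kernB.
- by move=> s; rewrite lee_fin mulr_ge0// kern_ge0.
under eq_integral => s _.
  rewrite addr0 -[X in (X - t * s)%R]mulr1 -mulrBr !kernZ// mulrACA EFinM.
  over.
rewrite /= ge0_integralZl//; last 3 first.
- apply/measurable_EFinP; apply: measurable_funM; last exact: measurable_kern.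
  exact: measurable_kernB.
- by move=> s _; rewrite lee_fin mulr_ge0// kern_ge0.
- by rewrite lee_fin mulr_ge0// powR_ge0.
rewrite muleA [RHS]muleC; congr (_ * _)%E.
rewrite kernE// -EFinM; congr EFin.
rewrite -powRD; last by apply/implyP => _; rewrite gt_eqF.
rewrite -[X in (X * _)%R](powRr1 (ltW t0)) -powRD; last by apply/implyP => _; rewrite gt_eqF.
by congr powR; ring.
Qed.

Lemma ebeta_ge0 a b : 0 <= ebeta a b.
Proof. by apply: integral_ge0 => s _; rewrite lee_fin mulr_ge0// kern_ge0. Qed.

Lemma egamma_ge0 a : 0 <= egamma a.
Proof. by apply: integral_ge0 => s _; rewrite lee_fin mulr_ge0// ?kern_ge0// expR_ge0. Qed.

Lemma measurable_gamma a : measurable_fun setT (fun z => (kern a z * expR (- z))%R).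
Proof.
apply: measurable_funM; first exact: measurable_kern.
by apply: measurableT_comp => //; exact: measurable_funN.
Qed.

(** In the double integral, shifting the variable of the first factor by [y] merges the exponentials
    into [expR (- t)]; after Tonelli the inner integral is a convolution of kernels. *)
Lemma egammaM a b : egamma a * egamma b = ebeta a b * egamma (a + b).
Proof.
rewrite {2}/egamma -ge0_integralZl//; last 3 first.
- by apply/measurable_EFinP; exact: measurable_gamma.
- by move=> s _; rewrite lee_fin mulr_ge0// ?kern_ge0// expR_ge0.
- exact: egamma_ge0.
transitivity (\int[mu]_y \int[mu]_t (kern a (t - y) * kern b y * expR (- t))%:E).
  apply: eq_integral => y _; rewrite muleC -ge0_integralZl//; last 3 first.
  - by apply/measurable_EFinP; exact: measurable_gamma.
  - by move=> s _; rewrite lee_fin mulr_ge0// ?kern_ge0// expR_ge0.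
  - by rewrite lee_fin mulr_ge0// ?kern_ge0// expR_ge0.
  under eq_integral do rewrite -EFinM.
  rewrite [LHS](@ge0_integral_affine _ 1%R (- y)%R)//; last 2 first.
  - by apply/measurable_EFinP; apply: measurable_funM => //; exact: (measurable_gamma a).
  - by move=> s; rewrite lee_fin !mulr_ge0// ?kern_ge0// expR_ge0.
  rewrite mul1e; apply: eq_integral => t _; rewrite mul1r.
  by rewrite mulrACA -expRD; congr EFin; rewrite [(kern b y * _)%R]mulrC; congr (_ * expR _)%R; ring.
pose k (z : measurableTypeR R * measurableTypeR R) :=
  (kern a (z.2 - z.1) * kern b z.1 * expR (- z.2))%:E.
rewrite (@fubini_tonelli _ _ _ _ _ mu mu k)//; last 2 first.
- apply/measurable_EFinP; apply: measurable_funM.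
    apply: measurable_funM; first apply: (measurableT_comp (measurable_kern a)).
      exact: measurable_funB.
    exact: (measurableT_comp (measurable_kern b)).
  by apply: measurableT_comp => //; exact: measurable_funN.
- by move=> z; rewrite lee_fin !mulr_ge0// ?kern_ge0// expR_ge0.
rewrite /egamma -ge0_integralZl//; last 3 first.
- by apply/measurable_EFinP; exact: measurable_gamma.
- by move=> s _; rewrite lee_fin mulr_ge0// ?kern_ge0// expR_ge0.
- exact: ebeta_ge0.
apply: eq_integral => t _; rewrite EFinM muleA -integral_kern_conv muleC.
rewrite -ge0_integralZl//; last 2 first.
- apply/measurable_EFinP; apply: measurable_funM; last exact: measurable_kern.
  exact: measurable_kernB.
- by move=> s _; rewrite lee_fin mulr_ge0// kern_ge0.
by apply: eq_integral => s _; rewrite /k/= -EFinM mulrC.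
Qed.

(** After Tonelli, the inner integral in [u] is a convolution of two kernels translated by [s]. *)
Lemma integral_kern_semigroup a b t (g : R -> R) :
  measurable_fun setT g -> (forall s, 0 <= g s)%R ->
  \int[mu]_u ((kern b (t - u))%:E * \int[mu]_s (kern a (u - s) * g s)%:E) =
  ebeta b a * \int[mu]_s (kern (a + b) (t - s) * g s)%:E.
Proof.
move=> mg g0.
pose k (z : measurableTypeR R * measurableTypeR R) :=
  (kern b (t - z.1) * (kern a (z.1 - z.2) * g z.2))%:E.
transitivity (\int[mu]_u \int[mu]_s k (u, s)).
  apply: eq_integral => u _; rewrite -ge0_integralZl//; last 3 first.
  - apply/measurable_EFinP; apply: measurable_funM => //; exact: measurable_kernB.
  - by move=> s _; rewrite lee_fin mulr_ge0// kern_ge0.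
  - by rewrite lee_fin kern_ge0.
rewrite fubini_tonelli//; last 2 first.
- apply/measurable_EFinP; apply: measurable_funM.
    by apply: (measurableT_comp (measurable_kern b)); exact: measurable_funB.
  apply: measurable_funM; last exact: (measurableT_comp mg).
  by apply: (measurableT_comp (measurable_kern a)); exact: measurable_funB.
- by move=> z; rewrite lee_fin !mulr_ge0// ?kern_ge0.
rewrite -ge0_integralZl//; last 3 first.
- apply/measurable_EFinP; apply: measurable_funM => //; exact: measurable_kernB.
- by move=> s _; rewrite lee_fin mulr_ge0// kern_ge0.
- exact: ebeta_ge0.
apply: eq_integral => s _; rewrite EFinM muleA.
rewrite addrC -integral_kern_conv muleC.
rewrite -ge0_integralZl//; last 3 first.
- apply/measurable_EFinP; apply: measurable_funM; last exact: measurable_kern.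
  exact: measurable_kernB.
- by move=> x _; rewrite lee_fin mulr_ge0// kern_ge0.
- by rewrite lee_fin.
rewrite [LHS](@ge0_integral_affine _ 1%R s
  (fun u => (kern b (t - u) * (kern a (u - s) * g s))%:E))//; last 2 first.
- apply/measurable_EFinP; apply: measurable_funM; first exact: measurable_kernB.
  apply: measurable_funM; last exact: measurable_cst.
  by apply: (measurableT_comp (measurable_kern a)); exact: measurable_funB.
- by move=> x; rewrite lee_fin !mulr_ge0// ?kern_ge0.
rewrite mul1e; apply: eq_integral => x _; rewrite mul1r -EFinM; congr EFin.
rewrite mulrA mulrC; congr (_ * (kern _ _ * kern _ _))%R; ring.
Qed.

End beta_gamma.

Section gamma.
Context {R : realType}.
Notation mu := (@lebesgue_measure R).
Implicit Types a b t x s : R.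

Lemma continuous_powR_gt0 (p x : R) : 0 < x -> {for x, continuous (fun y => y `^ p)}.
Proof.
move=> x0; apply: differentiable_continuous; apply/derivable1_diffP.
by apply: derivable_powR; rewrite in_itv/= x0.
Qed.

Lemma integral_powRB1 (s e : R) : 0 < s -> 0 < e -> e < 1 ->
  (\int[mu]_(x in `[e, 1%R]) (x `^ (s - 1))%:E = (s^-1 * (1 - e `^ s))%:E)%E.
Proof.
move=> s0 e0 e1.
have dF (x : R) : 0 < x -> is_derive x 1 (fun y => s^-1 * y `^ s) (x `^ (s - 1)).
  move=> x0; apply: (is_derive_eq (is_deriveZ s^-1 (is_derive1_powR s x0))).
  by rewrite scalerA mulVf ?scale1r// gt_eqF.
rewrite (@continuous_FTC2 _ _ (fun y => s^-1 * y `^ s))//.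
- by rewrite powR1 -EFinB mulrBr.
- apply: continuous_in_subspaceT => x; rewrite inE/= in_itv/= => /andP[ex _].
  by apply: continuous_powR_gt0; exact: lt_le_trans ex.
- have cF (x : R) : 0 < x -> {for x, continuous (fun y => s^-1 * y `^ s)}.
    move=> x0; apply: differentiable_continuous; apply/derivable1_diffP.
    by have [] := dF x x0.
  split.
  + move=> x; rewrite in_itv/= => /andP[ex _].
    by have [] := dF x (lt_trans e0 ex).
  + by apply: cvg_at_right_filter; exact: cF.
  + by apply: cvg_at_left_filter; exact: cF.
- move=> x; rewrite in_itv/= => /andP[ex _]; rewrite derive1E.
  by have [_ ->] := dF x (lt_trans e0 ex).
Qed.

Lemma ebeta1 (s : R) : 0 < s -> ebeta 1 s = s^-1%:E.
Proof.
move=> s0.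
rewrite /ebeta (_ : (fun x : R => _) = (fun x => (x `^ (s - 1))%:E) \_ `]0%R, 1%R[); last first.
  apply/funext => x; rewrite patchE /kern mem_setE in_itv/= subrr powRr0 subr_gt0.
  by case: (ltP x 1) => _; case: (ltP 0 x) => _ /=; rewrite ?mul1r ?mul0r.
rewrite -integral_mkcond integral_itv_bndo_bndc; last first.
  apply/measurable_funTS/measurable_EFinP; exact: measurable_powR.
(* The fundamental theorem is used away from the singularity at 0, and monotone convergence recovers
   the rest; the left ends start at 1/2 so that they stay below 1. *)
pose F (n : nat) : set R := [set` `[(n.+2%:R)^-1, 1%R]].
have -> : [set` `]0%R, 1%R]] = \bigcup_n F n.
  apply/seteqP; split=> [x /=|x [n _]]; rewrite /F/= !in_itv/=.
  - move=> /andP[x0 x1]; have [n xn] := ltr_add_invr x0.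
    exists n => //=; rewrite in_itv/= x1 andbT; rewrite add0r in xn.
    by rewrite (le_trans _ (ltW xn))// lef_pV2 ?posrE// ler_nat.
  - by move=> /andP[+ ->]; rewrite andbT; apply: lt_le_trans; rewrite invr_gt0.
have cF : (fun n => \int[mu]_(x in F n) (x `^ (s - 1))%:E)%E @ \oo -->
    (\int[mu]_(x in \bigcup_n F n) (x `^ (s - 1))%:E)%E.
  apply: ge0_nondecreasing_set_cvg_integral => //.
  - move=> n m nm; rewrite subsetEset; apply: subset_itvr; rewrite bnd_simp.
    by rewrite lef_pV2 ?posrE// ler_nat.
  - by move=> i; exact: measurable_itv.
  - by move=> i; apply/measurable_funTS/measurable_EFinP; exact: measurable_powR.
  - by move=> i x _; rewrite lee_fin powR_ge0.
apply/esym; apply: (cvg_unique _ _ cF) => //.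
rewrite (_ : (fun n => _) = (fun n => (s^-1 * (1 - (n.+2%:R^-1 `^ s)))%:E)); last first.
  apply/funext => n; apply: integral_powRB1 => //.
  by rewrite invf_lt1 // ltr1n.
apply: cvg_EFin; first exact: nearW.
rewrite [X in _ --> X](_ : _ = s^-1 * (1 - 0)); last by rewrite subr0 mulr1.
apply: cvgM; first exact: cvg_cst.
apply: cvgB; first exact: cvg_cst.
have h : (fun n => n.+2%:R^-1 : R) @ \oo --> (0 : R).
  by have := @cvg_harmonic R; rewrite -cvg_shiftS.
by have /cvg_at_rightP := powR_cvg0 s0; apply; split => // n; rewrite invr_gt0.
Qed.

End gamma.
Section gamma2.
Context {R : realType}.
Notation mu := (@lebesgue_measure R).
Implicit Types a b t x s : R.

Lemma egammaE s :
  egamma s = (\int[mu]_(x in `]0%R, +oo[) (x `^ (s - 1) * expR (- x))%:E)%E.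
Proof.
rewrite /egamma (_ : (fun x : R => _) =
    (fun x => (x `^ (s - 1) * expR (- x))%:E) \_ `]0%R, +oo[); last first.
  apply/funext => x; rewrite patchE /kern mem_setE in_itv/= andbT.
  by case: (ltP 0 x) => _ /=; rewrite ?mul0r.
by rewrite -integral_mkcond.
Qed.

Lemma Gamma_egamma s : Gamma s = fine (egamma s).
Proof. by rewrite egammaE. Qed.

Lemma egamma1 : @egamma R 1 = 1%E.
Proof.
rewrite -(@integral_exponential_pdf R 1)// egammaE.
rewrite (_ : (fun x : R => (exponential_pdf 1 x)%:E) =
    (fun x => (expR (- x))%:E) \_ `[0%R, +oo[); last first.
  apply/funext => x; rewrite /exponential_pdf !patchE mem_setE in_itv/= andbT.
  by case: (leP 0 x) => // x0; rewrite mul1r mulN1r.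
rewrite -integral_mkcond -integral_itv_obnd_cbnd//; last first.
  apply/measurable_funTS/measurable_EFinP.
  by apply: measurableT_comp => //; exact: measurable_funN.
by apply: eq_integral => x _; rewrite subrr powRr0 mul1r.
Qed.

Lemma egammaDl s : 0 < s -> egamma (1 + s) = (s%:E * egamma s)%E.
Proof.
move=> s0; have := egammaM 1 s; rewrite egamma1 mul1e ebeta1// => ->.
by rewrite muleA -EFinM mulfV ?mul1e// gt_eqF.
Qed.

(** For [0 < s <= 1] the integrand is at most [x ^ (s - 1)] before 1 and [expR (- x)] after it; the
    functional equation carries finiteness upwards by unit steps. *)
Lemma egamma_fin_num s : 0 < s -> egamma s \is a fin_num.
Proof.
have H (r : R) : 0 < r -> r <= 1 -> egamma r \is a fin_num.
  move=> r0 r1; rewrite ge0_fin_numE ?egamma_ge0//.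
  apply: (@le_lt_trans _ _ (ebeta 1%R r + egamma 1%R)%E); last first.
    by rewrite ebeta1// egamma1 ltry.

  rewrite /ebeta /egamma -ge0_integralD//; last 4 first.
  - by move=> x _; rewrite lee_fin mulr_ge0// kern_ge0.
  - apply/measurable_EFinP; apply: measurable_funM; last exact: measurable_kern.
    exact: measurable_kernB.
  - by move=> x _; rewrite lee_fin mulr_ge0// ?kern_ge0// expR_ge0.
  - by apply/measurable_EFinP; exact: measurable_gamma.
  apply: ge0_le_integral => //.
  - by move=> x _; rewrite lee_fin mulr_ge0// ?kern_ge0// expR_ge0.
  - by apply/measurable_EFinP; exact: measurable_gamma.
  - apply/measurable_EFinP; apply: measurable_funD; last exact: measurable_gamma.
    apply: measurable_funM; last exact: measurable_kern.
    exact: measurable_kernB.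
  - move=> x _; rewrite -EFinD lee_fin.
    have [x0|x0] := leP x 0; first by rewrite (kern_le0 r _ x0) (kern_le0 1 _ x0) mulr0 !mul0r addr0.
    have [x1|x1] := ltP x 1.
      rewrite (_ : kern 1 (1 - x) = 1); last first.
        by rewrite kernE ?subr_gt0// subrr powRr0.
      rewrite mul1r; apply: (@le_trans _ _ (kern r x)).
        by rewrite ler_piMr// ?kern_ge0// -expR0 ler_expR oppr_le0 ltW.
      by rewrite lerDl mulr_ge0 ?kern_ge0 ?expR_ge0.
    rewrite (_ : kern 1 x = 1); last by rewrite kernE// subrr powRr0.
    rewrite (_ : kern 1 (1 - x) = 0); last by rewrite kern_le0// subr_le0.
    rewrite mul0r add0r ler_pM2r ?expR_gt0// kernE//.
    by rewrite -[leRHS](powRr0 x) ler_powR// subr_le0.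
move=> s0.
have [n sn] : exists n : nat, s <= n.+1%:R.
  by exists (Num.truncn s); have /andP[_ /ltW] := truncn_itv (ltW s0).
elim: n s s0 sn => [|n IH] s s0 sn; first exact: H.
have [s1|s1] := leP s 1; first exact: H.
rewrite -(subrKC 1 s) egammaDl ?subr_gt0// fin_numM// IH ?subr_gt0//.
by rewrite lerBlDr -natr1 in sn *.
Qed.

Lemma EFin_Gamma s : 0 < s -> (Gamma s)%:E = egamma s.
Proof. by move=> s0; rewrite Gamma_egamma fineK// egamma_fin_num. Qed.

Lemma Gamma1 : Gamma (1 : R) = 1.
Proof. by rewrite Gamma_egamma egamma1. Qed.

Lemma GammaDl s : 0 < s -> Gamma (1 + s) = s * Gamma s.
Proof.
by move=> s0; rewrite !Gamma_egamma egammaDl// fineM// egamma_fin_num.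
Qed.

(** Integrating [x <= x ^ (s - 1) + max (x - 1) 0] for [x > 0] against [expR (- x)] gives
    [1 = Gamma 2 <= Gamma s + expR (- 1)], and [expR (- 1) <= 2/5]. *)
Lemma Gamma_ge s : 1 <= s -> s <= 2 -> 3 / 5 <= Gamma s.
Proof.
move=> s1 s2.
have G2 : @egamma R 2 = 1%E.
  by rewrite [2](_ : _ = 1 + 1)// egammaDl// egamma1 mul1e.
have shift : (\int[mu]_x (kern 2 (x - 1) * expR (- x))%:E = (expR (- 1))%:E)%E.
  rewrite (@ge0_integral_affine _ 1%R 1%R)//; last 2 first.
  - apply/measurable_EFinP; apply: measurable_funM.
      by apply: measurableT_comp (measurable_kern 2) _; exact: measurable_funB.
    by apply: measurableT_comp => //; exact: measurable_funN.
  - by move=> x; rewrite lee_fin mulr_ge0// ?kern_ge0// expR_ge0.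
  rewrite mul1e -[RHS]mule1 -G2 /egamma -ge0_integralZl//; last 2 first.
  - by apply/measurable_EFinP; exact: measurable_gamma.
  - by move=> x _; rewrite lee_fin mulr_ge0// ?kern_ge0// expR_ge0.
  apply: eq_integral => x _; rewrite -EFinM; congr EFin.
  by rewrite mul1r addrK mulrCA -expRD opprD [in RHS]addrC.
(* From [expR y >= 1 + y] at [y = 1/8], raised to the power 8. *)
have e52 : 5 / 2 <= expR (1 : R).
  have -> : (1 : R) = 8%:R * 8%:R^-1 by field.
  rewrite expRM_natl.
  apply: (@le_trans _ _ ((9 / 8) ^+ 8)); first by lra.
  by apply: lerXn2r; rewrite ?nnegrE ?expR_ge0//; have := expR_ge1Dx (8%:R^-1 : R); lra.
have einv : expR (- 1) <= 2 / 5 :> R.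
  rewrite expRN (_ : 2 / 5 = (5 / 2)^-1); last by field.
  by rewrite lef_pV2 ?posrE ?expR_gt0//; lra.
suff : (egamma 2 <= egamma s + (expR (- 1))%:E)%E.
  rewrite G2 -EFin_Gamma ?(lt_le_trans _ s1)// -EFinD lee_fin; lra.
rewrite -shift /egamma -ge0_integralD//; last 4 first.
- by move=> x _; rewrite lee_fin mulr_ge0// ?kern_ge0// expR_ge0.
- by apply/measurable_EFinP; exact: measurable_gamma.
- by move=> x _; rewrite lee_fin mulr_ge0// ?kern_ge0// expR_ge0.
- apply/measurable_EFinP; apply: measurable_funM.
    by apply: measurableT_comp (measurable_kern 2) _; exact: measurable_funB.
  by apply: measurableT_comp => //; exact: measurable_funN.
apply: ge0_le_integral => //.
- by move=> x _; rewrite lee_fin mulr_ge0// ?kern_ge0// expR_ge0.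
- by apply/measurable_EFinP; exact: measurable_gamma.
- apply/measurable_EFinP; apply: measurable_funD; first exact: measurable_gamma.
  apply: measurable_funM.
    by apply: measurableT_comp (measurable_kern 2) _; exact: measurable_funB.
  by apply: measurableT_comp => //; exact: measurable_funN.
- move=> x _; rewrite -EFinD lee_fin -mulrDl ler_pM2r ?expR_gt0//.
  have [x0|x0] := leP x 0.
    by rewrite (kern_le0 2 _ x0) addr_ge0 ?kern_ge0.
  have k2 (y : R) : 0 < y -> kern 2 y = y.
    by move=> y0; rewrite kernE// (_ : 2 - 1 = 1 :> R) ?powRr1 ?(ltW y0)//; lra.
  rewrite k2//.
  have [x1|x1] := leP x 1.
    rewrite (kern_le0 2) ?subr_le0// addr0 kernE//.
    rewrite -{1}(powRr1 (ltW x0)) ger_powR ?x0//; lra.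
  rewrite k2 ?subr_gt0// kernE//.
  suff : 1 <= x `^ (s - 1) by lra.
  by rewrite -[leLHS](powRr0 x) ler_powR ?subr_ge0// ltW.
Qed.

Lemma Gamma_gt0 s : 0 < s -> 0 < Gamma s.
Proof.
have H (r : R) : 0 < r -> r <= 1 -> 0 < Gamma r.
  move=> r0 r1; have : 3 / 5 <= Gamma (1 + r) by apply: Gamma_ge; lra.
  rewrite GammaDl// => h; rewrite -(pmulr_rgt0 _ r0); apply: lt_le_trans h; lra.
move=> s0.
have [n sn] : exists n : nat, s <= n.+1%:R.
  by exists (Num.truncn s); have /andP[_ /ltW] := truncn_itv (ltW s0).
elim: n s s0 sn => [|n IH] s s0 sn; first exact: H.
have [s1|s1] := leP s 1; first exact: H.
rewrite -(subrKC 1 s) GammaDl ?subr_gt0// mulr_gt0 ?subr_gt0// IH ?subr_gt0//.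
by rewrite lerBlDr -natr1 in sn *.
Qed.

(** An infinite [ebeta a b] would make the right side of [egammaM] infinite, [Gamma (a + b)] being
    positive, while the left side is finite. *)
Lemma EFin_ebeta a b : 0 < a -> 0 < b ->
  ebeta a b = (Gamma a * Gamma b / Gamma (a + b))%:E.
Proof.
move=> a0 b0; have ab0 : 0 < a + b by exact: addr_gt0.
have := egammaM a b; rewrite -!EFin_Gamma// -EFinM => /esym E.
have : ebeta a b \is a fin_num.
  rewrite ge0_fin_numE ?ebeta_ge0// ltey; apply/eqP => bE.
  by move: E; rewrite bE gt0_mulye ?lte_fin ?Gamma_gt0.
move=> /fineK bE; rewrite -bE -EFinM in E *; case: E => <-.
by congr EFin; rewrite mulfK// gt_eqF// Gamma_gt0.
Qed.

End gamma2.

(** * Riemann-Liouville integrals *)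

Section riemann_liouville.
Context {R : realType}.
Notation mu := (@lebesgue_measure R).
Implicit Types a b t s u : R.
Variables (g : R -> R) (M : R).
Hypothesis cg : continuous g.
Hypothesis g0 : forall s, 0 <= g s.
Hypothesis gM : forall s, g s <= M.

Definition restr_pos (h : R -> R) (s : R) := kern 1 s * h s.
Notation gp := (restr_pos g).

(* Gamma a times the usual Riemann-Liouville integral of order a based at 0. *)
Definition eRL (a t : R) : \bar R := (\int[mu]_s (kern a (t - s) * gp s)%:E)%E.
Definition RL (a t : R) : R := fine (eRL a t).

Lemma kern1 (s : R) : 0 < s -> kern 1 s = 1.
Proof. by move=> s0; rewrite kernE// subrr powRr0. Qed.

Lemma measurable_g : measurable_fun setT g.
Proof. exact: continuous_measurable_fun. Qed.

Lemma measurable_restr_pos : measurable_fun setT gp.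
Proof. by apply: measurable_funM; [exact: measurable_kern|exact: measurable_g]. Qed.

Lemma restr_pos_ge0 s : 0 <= gp s.
Proof. by rewrite mulr_ge0// kern_ge0. Qed.

Lemma restr_pos_le s : gp s <= M * kern 1 s.
Proof. by rewrite mulrC ler_wpM2l// kern_ge0. Qed.

Lemma measurable_RL a t : measurable_fun setT (fun s : R => kern a (t - s) * gp s).
Proof. by apply: measurable_funM; [exact: measurable_kernB|exact: measurable_restr_pos]. Qed.

Lemma eRL_ge0 a t : (0 <= eRL a t)%E.
Proof. by apply: integral_ge0 => s _; rewrite lee_fin mulr_ge0// ?kern_ge0 ?restr_pos_ge0. Qed.

Lemma bound_ge0 : 0 <= M. Proof. exact: le_trans (g0 0) (gM 0). Qed.

Lemma eRL_fin_num a t : 0 < a -> eRL a t \is a fin_num.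
Proof.
move=> a0; rewrite ge0_fin_numE ?eRL_ge0//.
apply: (@le_lt_trans _ _ (M%:E * (ebeta a 1%R * (kern (a + 1)%R t)%:E))%E); last first.
  by rewrite EFin_ebeta// -EFinM ltry.
rewrite -integral_kern_conv -ge0_integralZl//; last 3 first.
- apply/measurable_EFinP; apply: measurable_funM; last exact: measurable_kern.
  exact: measurable_kernB.
- by move=> s _; rewrite lee_fin mulr_ge0// kern_ge0.
- by rewrite lee_fin bound_ge0.
apply: ge0_le_integral => //.
- by move=> s _; rewrite lee_fin mulr_ge0// ?kern_ge0 ?restr_pos_ge0.
- by apply/measurable_EFinP; exact: measurable_RL.
- apply: measurable_funeM; apply/measurable_EFinP.
  by apply: measurable_funM; [exact: measurable_kernB|exact: measurable_kern].
- move=> s _; rewrite -EFinM lee_fin [leRHS]mulrCA.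
  by rewrite ler_wpM2l ?kern_ge0// restr_pos_le.
Qed.

Lemma EFin_RL a t : 0 < a -> (RL a t)%:E = eRL a t.
Proof. by move=> a0; rewrite fineK// eRL_fin_num. Qed.

Lemma RL_ge0 a t : 0 <= RL a t.
Proof. by rewrite fine_ge0// eRL_ge0. Qed.

Lemma RL_le0 a t : t <= 0 -> RL a t = 0.
Proof.
move=> t0; rewrite /RL /eRL integral0_eq// => s _; rewrite /restr_pos.
have [s0|s0] := leP s 0; first by rewrite (kern_le0 1 _ s0) mul0r mulr0.
by rewrite kern_le0 ?mul0r// subr_le0 (le_trans t0)// ltW.
Qed.

Lemma integral_RL a b t : 0 < a -> 0 < b ->
  (\int[mu]_u (kern b (t - u) * RL a u)%:E =
   (Gamma b * Gamma a / Gamma (a + b) * RL (a + b) t)%:E)%E.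
Proof.
move=> a0 b0.
transitivity (ebeta b a * eRL (a + b) t)%E.
  rewrite -(@integral_kern_semigroup R a b t gp measurable_restr_pos restr_pos_ge0).
  by apply: eq_integral => u _; rewrite EFinM (EFin_RL _ _ a0).
by rewrite (EFin_ebeta _ _ b0 a0) -(EFin_RL _ _ (addr_gt0 a0 b0)) [b + a]addrC.
Qed.

(** Moves [t] from the singular kernel into [g], so that the singularity stays at the fixed point 0
    when [t] varies. *)
Lemma RL_subst a t : eRL a t = (\int[mu]_s (kern a s * gp (t - s))%:E)%E.
Proof.
rewrite /eRL -(@ge0_integral_subl _ t); first by apply: eq_integral => s _; rewrite subKr.
- by apply/measurable_EFinP; exact: measurable_RL.
- by move=> s; rewrite lee_fin mulr_ge0// ?kern_ge0 ?restr_pos_ge0.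
Qed.

End riemann_liouville.

Lemma continuous_kern {R : realType} (a : R) : 1 < a -> continuous (kern a).
Proof.
move=> a1 t.
have [t0|t0|->] := ltgtP t 0.
- rewrite /continuous_at (kern_le0 _ _ (ltW t0)).
  apply: (@cvg_trans _ ((fun _ : R => 0 : R) @ nbhs t)); last exact: cvg_cst.
  apply: near_eq_cvg; near=> x; rewrite kern_le0// ltW//.
  by near: x; exact: (lt_nbhsl t0).
- rewrite /continuous_at kernE//.
  apply: (@cvg_trans _ ((fun x : R => x `^ (a - 1)) @ nbhs t)); last exact: continuous_powR_gt0.
  by apply: near_eq_cvg; near=> x; rewrite kernE//; near: x; exact: (lt_nbhsr t0).
- apply/left_right_continuousP; rewrite (kern_le0 _ _ (lexx 0)); split.
  + apply: (@cvg_trans _ ((fun _ : R => 0 : R) @ (0:R)^'-)); last exact: cvg_cst.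
    by apply: near_eq_cvg; near=> x; rewrite kern_le0// ltW.
  + apply: (@cvg_trans _ ((fun x => x `^ (a - 1)) @ (0:R)^'+)).
      by apply: near_eq_cvg; near=> x; rewrite kernE.
    by apply: powR_cvg0; rewrite subr_gt0.
Unshelve. all: end_near. Qed.

Section riemann_liouville_regularity.
Context {R : realType}.
Notation mu := (@lebesgue_measure R).
Implicit Types a b t s u p : R.
Variables (g : R -> R) (M : R).
Hypothesis cg : continuous g.
Hypothesis g0 : forall s, 0 <= g s.
Hypothesis gM : forall s, g s <= M.
Notation gp := (restr_pos g).

Lemma integrable_kern_conv a b t : 0 < a -> 0 < b ->
  mu.-integrable setT (EFin \o (fun s => kern a (t - s) * kern b s)).
Proof.
move=> a0 b0; apply/integrableP; split.
  apply/measurable_EFinP.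
  by apply: measurable_funM; [exact: measurable_kernB|exact: measurable_kern].
under eq_integral do rewrite /= ger0_norm ?mulr_ge0 ?kern_ge0//.
by rewrite integral_kern_conv EFin_ebeta// -EFinM ltry.
Qed.

(** [restr_pos g] jumps by [g 0] at 0. That jump is split off and contributes an explicit multiple
    of [kern (1 + p) t]. What remains, [f t s], is continuous in [t] for each [s], and its cut at
    [T] leaves an integrable bound that does not depend on [t]. *)
Lemma continuous_RL p : 0 < p -> continuous (RL g p).
Proof.
move=> p0 t0.
pose T := t0 + 1.
pose f t s := kern 1 (T - s) * kern p s * (g (Num.max (t - s) 0) - g 0).
have mf t : measurable_fun setT (f t).
  apply: measurable_funM.
    by apply: measurable_funM; [exact: measurable_kernB|exact: measurable_kern].
  apply: measurable_funB; last by [].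
  apply: continuous_measurable_fun => s.
  apply: (@continuous_comp _ _ _ (fun x => Num.max (t - x) 0) g); last exact: cg.
  apply: continuous_max; last exact: cst_continuous.
  by apply: continuousB; [exact: cst_continuous|exact: id].
have fM t s : `|f t s| <= kern 1 (T - s) * kern p s * M.
  rewrite normrM ger0_norm ?mulr_ge0 ?kern_ge0//.
  rewrite ler_wpM2l ?mulr_ge0 ?kern_ge0//.
  have := g0 (Num.max (t - s) 0); have := gM (Num.max (t - s) 0).
  by have := g0 0; have := gM 0; rewrite ler_norml; lra.
have iG : mu.-integrable setT (EFin \o (fun s => kern 1 (T - s) * kern p s * M)).
  under [X in integrable _ _ X]funext do rewrite /= EFinM.
  by apply: integrableZr => //; exact: integrable_kern_conv.
have intf t : mu.-integrable setT (EFin \o f t).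
  apply: (le_integrable measurableT _ _ iG).
    by apply/measurable_EFinP; exact: mf.
  by move=> s _ /=; rewrite lee_fin (le_trans (fM t s)) ?ler_norm.
have E t : t < T -> RL g p t = (\int[mu]_s f t s) + g 0 * (p^-1 * kern (1 + p) t).
  move=> tT.
  have -> : p^-1 * kern (1 + p) t = \int[mu]_s (kern 1 (t - s) * kern p s).
    by rewrite /Rintegral integral_kern_conv ebeta1// -EFinM.
  rewrite -RintegralZl//; last exact: integrable_kern_conv.
  rewrite -RintegralD//; last first.
    under [X in integrable _ _ X]funext do rewrite /= EFinM.
    by apply: integrableZl => //; exact: integrable_kern_conv.
  rewrite /RL RL_subst//; congr fine; apply: eq_integral => s _; congr EFin.
  rewrite /f /restr_pos.
  have [ts|ts] := leP t s.
    by rewrite (kern_le0 1 (t - s)) ?subr_le0// !mul0r !mulr0 max_r ?subr_le0// subrr mulr0 addr0.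
  rewrite !kern1 ?subr_gt0// ?(lt_trans ts)// !mul1r max_l ?subr_ge0 ?(ltW ts)//.
  ring.
have cF : {for t0, continuous (fun t => (\int[mu]_s f t s) + g 0 * (p^-1 * kern (1 + p) t))}.
  apply: cvgD; last first.
    apply: cvgM; first exact: cvg_cst.
    apply: cvgM; first exact: cvg_cst.
    by apply: continuous_kern; rewrite ltrDl.
  apply: (@continuity_under_integral _ _ _ mu f setT measurableT (t0 - 1) T _ _
     (fun s => kern 1 (T - s) * kern p s * M)) => //.
  - apply: aeW => s _ t _; apply: cvgM; first exact: cvg_cst.
    apply: cvgB; last exact: cvg_cst.
    apply: (@continuous_comp _ _ _ (fun x => Num.max (x - s) 0) g); last exact: cg.
    apply: continuous_max; last exact: cst_continuous.
    by apply: continuousB; [exact: id|exact: cst_continuous].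
  - by move=> t _; apply: aeW => s _; exact: fM.
  - by rewrite inE/= in_itv/= /T; apply/andP; split; lra.
rewrite /continuous_at E ?ltrDl//.
apply: cvg_trans cF; apply: near_eq_cvg; near=> t; rewrite E//.
by near: t; apply: lt_nbhsl; rewrite ltrDl.
Unshelve. end_near. Qed.

Lemma continuous_integral_derive (h : R -> R) c t : continuous h -> c < t ->
  is_derive t 1 (fun x => \int[mu]_(u in `[c, x]) h u) (h t).
Proof.
move=> ch ct.
have ih : mu.-integrable `[c, t + 1] (EFin \o h).
  apply: continuous_compact_integrable; first exact: segment_compact.
  exact: continuous_subspaceT.
have [dF F'] := @continuous_FTC1_closed _ h c t (t + 1) (ltr_pwDr ltr01 (lexx t)) ih ct (ch t).
by split; rewrite -?derive1E.
Qed.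

Lemma is_derive_RL p t : 0 < p -> is_derive t 1 (RL g (p + 1)) (p * RL g p t).
Proof.
move=> p0.
(* [RL g p] vanishes up to 0, so starting the integral at some [c < 0] does not change it and makes
   [t], even [t = 0], an interior point: the derivative is two-sided. *)
have [c ct c0] : exists2 c : R, c < t & c < 0.
  by have [t0|t0] := leP t 0; [exists (t - 1)|exists (- 1)]; lra.
have E (x : R) : c < x -> RL g (p + 1) x = p * \int[mu]_(u in `[c, x]) RL g p u.
  move=> cx; have := @integral_RL _ g M cg g0 gM p 1 x p0 ltr01.
  rewrite Gamma1 mul1r [p + 1]addrC GammaDl// [1 + p]addrC => E.
  have -> : (\int[mu]_(u in `[c, x]) RL g p u) =
      Gamma p / (p * Gamma p) * RL g (p + 1) x.
    rewrite /Rintegral -[RHS]/(fine _%:E) -E; congr fine.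
    rewrite -integral_itv_bndo_bndc; last first.
      apply/measurable_funTS/measurable_EFinP; apply: continuous_measurable_fun; exact: continuous_RL.
    rewrite integral_mkcond; apply: eq_integral => u _.
    rewrite patchE mem_setE in_itv/=.
    have [cu|cu] := leP c u; last by rewrite RL_le0 ?mulr0// ltW// (lt_trans cu).
    have [ux|xu] := ltP u x; first by rewrite kern1 ?mul1r// subr_gt0.
    by rewrite kern_le0 ?mul0r// subr_le0.
  have G0 : Gamma p != 0 by rewrite gt_eqF// Gamma_gt0.
  by field; rewrite G0 gt_eqF.
have D : is_derive t 1 (fun x : R => p * \int[mu]_(u in `[c, x]) RL g p u) (p * RL g p t) :=
  is_deriveZ p (continuous_integral_derive _ _ _ (continuous_RL _ p0) ct).
apply: near_eq_is_derive D.
by near=> x; rewrite E//; near: x; exact: lt_nbhsr.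
Unshelve. end_near. Qed.

(** [RL g 1] vanishes for [t <= 0] and has a corner at 0 when [g 0] is not 0; [H] is a smooth
    continuation of its right branch. *)
Lemma RL1_primitive : exists H : R -> R,
  (forall t, -1 < t -> is_derive t 1 H (g t)) /\ (forall t, 0 <= t -> RL g 1 t = H t).
Proof.
exists (fun x => (\int[mu]_(u in `[-1, x]) g u) - \int[mu]_(u in `[-1, 0]) g u); split.
  move=> t t1.
  have := is_deriveB (continuous_integral_derive _ _ _ cg t1)
    (is_derive_cst (\int[mu]_(u in `[-1, 0]) g u) t 1).
  by rewrite subr0.
move=> t t0.
have ig : mu.-integrable `[-1, t] (EFin \o g).
  apply: continuous_compact_integrable; first exact: segment_compact.
  exact: continuous_subspaceT.
rewrite Rintegral_itvB//; last first.
  by rewrite bnd_simp lerN10.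
rewrite /RL /eRL /Rintegral; congr fine.
rewrite -integral_itv_bndo_bndc; last first.
  apply/measurable_funTS/measurable_EFinP; exact: continuous_measurable_fun.
rewrite [RHS]integral_mkcond; apply: eq_integral => u _.
rewrite patchE mem_setE in_itv/= /restr_pos.
have [u0|u0] := ltP 0 u; last by rewrite (kern_le0 1 u)// mul0r mulr0.
have [ux|xu] := ltP u t; first by rewrite !kern1 ?mul1r// subr_gt0.
by rewrite kern_le0 ?mul0r// subr_le0.
Qed.

End riemann_liouville_regularity.

(** * The a priori estimate *)

Section monotone.
Context {R : realType}.
Implicit Types a b c t d e : R.

Lemma is_derive_continuous (Y : R -> R) t d : is_derive t 1 Y d -> {for t, continuous Y}.
Proof. by move=> [? _]; apply: differentiable_continuous; exact/derivable1_diffP. Qed.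

Lemma derive_ge0_right (Y : R -> R) c b d e :
  c < b -> is_derive c 1 Y d -> 0 <= d -> 0 < e ->
  exists2 t, c < t < b & Y c - e * (t - c) <= Y t.
Proof.
move=> cb [dY dE] d0 e0.
have : h^-1 *: (Y (h *: 1 + c) - Y c) @[h --> 0^'] --> d by rewrite -dE.
move=> /cvgr_dist_lt/(_ e e0) [r /= r0 H].
pose h := Num.min (r / 2) ((b - c) / 2).
have h0 : 0 < h by rewrite lt_min !divr_gt0// subr_gt0.
have hr : h < r by rewrite gt_min; apply/orP; left; lra.
have hb : h < b - c by rewrite gt_min; apply/orP; right; lra.
exists (h + c); first by apply/andP; split; lra.
have hball : ball_ Num.norm 0 r h by rewrite /ball_/= sub0r normrN gtr0_norm.
have := H h hball; rewrite /= gt_eqF// => /(_ isT); rewrite ltr_norml => /andP[_].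
rewrite -[h%:A]/(h * 1) mulr1 -[h^-1 *: _]/(h^-1 * _) addrK => dh.
have : - e < h^-1 * (Y (h + c) - Y c) by lra.
rewrite mulrC ltr_pdivlMr//; lra.
Qed.

(** Only the function that attains the maximum has to have a nonnegative derivative at a given
    point. Tilt the maximum by a slope [e']. If the tilted function were maximal at some [c < b],
    then just to the right of [c] the untilted one would lose at most half of the slope, so the
    tilted one would still grow. *)
Lemma max_nondecreasing (Y1 Y2 d1 d2 : R -> R) a b :
  a <= b ->
  (forall t, a <= t <= b -> is_derive t 1 Y1 (d1 t)) ->
  (forall t, a <= t <= b -> is_derive t 1 Y2 (d2 t)) ->
  (forall t, a <= t <= b -> (Y2 t <= Y1 t /\ 0 <= d1 t) \/ (Y1 t <= Y2 t /\ 0 <= d2 t)) ->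
  Num.max (Y1 a) (Y2 a) <= Num.max (Y1 b) (Y2 b).
Proof.
move=> ab D1 D2 D.
pose m t := Num.max (Y1 t) (Y2 t).
rewrite -/(m a) -/(m b); apply/ler_addgt0Pr => e e0.
(* The total tilt [e' (b - a)] is at most [e]; the added 1 covers [a = b]. *)
pose e' := e / (b - a + 1).
have ba1 : 0 < b - a + 1 by lra.
have e'0 : 0 < e' by rewrite divr_gt0.
pose G t := m t + e' * (t - a).
have cG : {within `[a, b], continuous G}.
  apply: continuous_in_subspaceT => t; rewrite inE/= in_itv/= => tab.
  apply: cvgD; last first.
    apply: cvgM; first exact: cvg_cst.
    by apply: cvgB; [exact: cvg_id|exact: cvg_cst].
  apply: continuous_max; first exact: is_derive_continuous (D1 t tab).
  exact: is_derive_continuous (D2 t tab).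
have [c cab cmax] := EVT_max ab cG.
rewrite in_itv/= in cab.
suff cb : c = b.
  have := cmax a; rewrite in_itv/= lexx ab => /(_ isT).
  rewrite /G cb subrr mulr0 addr0 => /le_trans; apply.
  by rewrite lerD2l /e' mulrAC ler_pdivrMr// ler_wpM2l ?(ltW e0)//; lra.
apply/eqP; rewrite eq_le; move: (cab) => /andP[ac ->] /=.
rewrite leNgt; apply/negP => cb.
have e2 : 0 < e' / 2 by rewrite divr_gt0.
have [t /andP[ct tb] mt] : exists2 t, c < t < b & m c - e' / 2 * (t - c) <= m t.
  have [[Y21 d0]|[Y12 d0]] := D c cab.
    have [t tb Yt] := @derive_ge0_right Y1 c b _ (e' / 2) cb (D1 c cab) d0 e2.
    by exists t => //; rewrite /m [Num.max (Y1 c) _]max_l// le_max Yt.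
  have [t tb Yt] := @derive_ge0_right Y2 c b _ (e' / 2) cb (D2 c cab) d0 e2.
  by exists t => //; rewrite /m [Num.max (Y1 c) _]max_r// le_max Yt orbT.
have := cmax t; rewrite in_itv/= (ltW tb) (ltW (le_lt_trans ac ct)) => /(_ isT).
rewrite /G => Gle; have : 0 < e' / 2 * (t - c) by rewrite mulr_gt0// subr_gt0.
lra.
Qed.

Lemma nondecreasing_derive (Y d : R -> R) a b :
  a <= b ->
  (forall t, a <= t <= b -> is_derive t 1 Y (d t)) ->
  (forall t, a <= t <= b -> 0 <= d t) -> Y a <= Y b.
Proof.
move=> ab D d0; have := @max_nondecreasing Y Y d d a b ab D D.
by rewrite !maxxx; apply => t tab; left; split => //; exact: d0.
Qed.

End monotone.

Section a_priori.
Context {R : realType}.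
Implicit Types t x : R.
Variables (w phi k Q U lam F C A Theta : R -> R) (d r gamma lo : R).
Hypotheses (d0 : 0 < d) (lo0 : lo < 0) (lod : lo * d < d - r).
Hypothesis w0 : forall t, 0 <= t < 1 -> 0 <= w t.
Hypothesis phi0 : forall t, 0 <= t < 1 -> 0 <= phi t.
Hypothesis lam01 : forall t, 0 <= t < 1 -> 0 <= lam t <= 1.
Hypothesis wlam : forall t, 0 <= t < 1 -> w t * gamma = d * lam t ^+ 2.
Hypothesis Qgamma : forall t, 0 <= t < 1 -> gamma <= Q t.
Hypothesis U1 : forall t, 0 <= t < 1 -> 1 <= U t.
Hypothesis DF : forall t, 0 <= t < 1 -> is_derive t 1 F (w t * phi t).
Hypothesis DC : forall t, 0 <= t < 1 -> is_derive t 1 C (w t * (Q t * U t)).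
Hypothesis DA : forall t, 0 <= t < 1 -> is_derive t 1 A (d * (2 * lam t - lam t ^+ 2)).
Hypothesis DTheta : forall t, lo < t < 1 -> is_derive t 1 Theta (U (Num.max t 0))^-1.
Hypotheses (F0 : F 0 = 0) (C0 : C 0 = 0) (A0 : A 0 = 0).

Definition phase t := (F t - (r - d)) / d.

Hypothesis phi_le : forall t, 0 <= t < 1 -> phase t < 1 ->
  phi t <= Q t * U (Num.max (phase t) t).

Lemma is_derive_phase t : 0 <= t < 1 -> is_derive t 1 phase (w t * phi t / d).
Proof.
move=> t01.
have D := is_deriveZ d^-1 (is_deriveB (DF t t01) (is_derive_cst (r - d) t 1)).
have -> : phase = d^-1 \*: (F - cst (r - d)).
  by apply/funext => x; rewrite /phase mulrC.
by apply: (is_derive_eq D); rewrite subr0 -[_ *: _]/(_ * _) [LHS]mulrC.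
Qed.

Lemma phase_nondecreasing a b : 0 <= a -> a <= b -> b < 1 -> phase a <= phase b.
Proof.
move=> a0 ab b1; apply: (@nondecreasing_derive _ _ (fun t => w t * phi t / d)) => //.
- by move=> t /andP[a_t tb]; apply: is_derive_phase; apply/andP; split; lra.
- move=> t /andP[a_t tb]; have t01 : 0 <= t < 1 by apply/andP; split; lra.
  by rewrite divr_ge0 ?mulr_ge0 ?w0 ?phi0// ltW.
Qed.

Lemma Theta_le x t : lo < x -> x <= t -> t < 1 -> Theta t - Theta x <= t - x.
Proof.
move=> lox xt t1.
suff : x - Theta x <= t - Theta t by lra.
apply: (@nondecreasing_derive _ (fun x => x - Theta x) (fun x => 1 - (U (Num.max x 0))^-1)) => //.
- by move=> y /andP[xy yt]; apply: is_deriveB; apply: DTheta; apply/andP; split; lra.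
- move=> y /andP[_ yt]; rewrite subr_ge0 invf_le1.
    by apply: U1; rewrite le_max lexx orbT gt_max ltr01 andbT/=; lra.
  apply: (lt_le_trans ltr01); apply: U1.
  by rewrite le_max lexx orbT gt_max ltr01 andbT/=; lra.
Qed.

Lemma A_nondecreasing a b : 0 <= a -> a <= b -> b < 1 -> A a <= A b.
Proof.
move=> a0 ab b1; apply: (@nondecreasing_derive _ _ (fun t => d * (2 * lam t - lam t ^+ 2))) => //.
- by move=> t /andP[a_t tb]; apply: DA; apply/andP; split; lra.
- move=> t /andP[a_t tb]; have t01 : 0 <= t < 1 by apply/andP; split; lra.
  have /andP[l0 l1] := lam01 t t01.
  by rewrite mulr_ge0 ?(ltW d0)//; nra.
Qed.

(* The right-hand side is d (lam^2 (U - 1) + 1 / U); minimising it over U >= 1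
   gives the derivative of the barrier A, attained at U = 1 / lam. *)
Lemma amgm_rate t : 0 <= t < 1 ->
  d * (2 * lam t - lam t ^+ 2) <= w t * gamma * (U t - 1) + d * (U t)^-1.
Proof.
move=> t01; rewrite wlam// -subr_ge0.
have U0 : 0 < U t by apply: lt_le_trans ltr01 (U1 t t01).
rewrite (_ : _ - _ = d * ((U t)^-1 * (lam t * U t - 1) ^+ 2)).
  by rewrite mulr_ge0 ?(ltW d0)// mulr_ge0 ?sqr_ge0// invr_ge0 ltW.
by field; rewrite gt_eqF.
Qed.

(* phi is controlled by U at max (phase t, t).  The first of the two functions
     Y1 = C - A - d (phase - id),   Y2 = C - A - d (Theta phase - Theta),
   is nondecreasing where phase <= id and the second where phase >= id, and there
   they are respectively the larger one, Theta being a contraction.  So their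
   maximum is nondecreasing throughout, whatever the crossings of phase and id. *)
Lemma a_priori eta t1 : 0 < eta < 1 -> 0 <= t1 < 1 -> phase t1 = 1 - eta ->
  exists2 T, 0 <= T < 1 & r - d + A (1 - eta) - d * eta <= C T.
Proof.
move=> /andP[eta0 eta1] /andP[t10 t11] phase1.
pose Y1 t := C t - A t - d * (phase t - t).
(* [Theta] is a primitive of [1 / U], so differentiating [Theta (phase t)] divides by [U (phase t)],
   which is the very factor in the bound on [phi] when the phase is ahead of [t]. *)
pose Y2 t := C t - A t - d * (Theta (phase t) - Theta t).
pose e1 t := w t * (Q t * U t) - d * (2 * lam t - lam t ^+ 2) - d * (w t * phi t / d - 1).
pose e2 t := w t * (Q t * U t) - d * (2 * lam t - lam t ^+ 2) -
  d * (w t * phi t / d * (U (Num.max (phase t) 0))^-1 - (U (Num.max t 0))^-1).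
have dK (x : R) : d * (x / d) = x by rewrite mulrCA mulfV ?mulr1// gt_eqF.
have t01 t : 0 <= t <= t1 -> 0 <= t < 1.
  by move=> /andP[t0 tt1]; rewrite t0 (le_lt_trans tt1).
have ph t : 0 <= t <= t1 -> phase t < 1.
  move=> /andP[t0 tt1]; have := @phase_nondecreasing t t1 t0 tt1 t11; lra.
have lopt t : 0 <= t <= t1 -> lo < phase t.
  move=> /andP[t0 tt1]; apply: lt_le_trans (phase_nondecreasing 0 t (lexx 0) t0 (le_lt_trans tt1 t11)).
  by rewrite /phase F0 ltr_pdivlMr//; move: lod; lra.
have lot t : 0 <= t -> lo < t by move=> t0; exact: lt_le_trans t0.
have Uge (x : R) : x < 1 -> 1 <= U (Num.max x 0).
  by move=> x1; apply: U1; rewrite le_max lexx orbT gt_max ltr01 x1.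
have M : Num.max (Y1 0) (Y2 0) <= Num.max (Y1 t1) (Y2 t1).
  apply: (@max_nondecreasing _ Y1 Y2 e1 e2) => //.
  - move=> t tt; have tt1 := t01 t tt.
    apply: is_deriveB; first by apply: is_deriveB; [exact: DC|exact: DA].
    apply: (@is_deriveZ _ _ _ (fun t => phase t - t)).
    by apply: is_deriveB; exact: is_derive_phase.
  - move=> t tt; have tt1 := t01 t tt; have pt := ph t tt.
    apply: is_deriveB; first by apply: is_deriveB; [exact: DC|exact: DA].
    apply: (@is_deriveZ _ _ _ (fun t => Theta (phase t) - Theta t)).
    apply: is_deriveB; last by apply: DTheta; case/andP: tt1 => t0' ->; rewrite lot.
    by apply: (is_derive_eq (is_derive1_comp
      (DTheta _ (introT andP (conj (lopt t tt) pt))) (is_derive_phase t tt1))); rewrite mulrC.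
  - move=> t tt; have tt1 := t01 t tt; have pt := ph t tt; have /andP[tge0 tlt1] := tt1.
    have := phi_le t tt1 pt; have wt := w0 t tt1.
    have [pht|pht] := leP (phase t) t => phit.
      left; split.
        by rewrite /Y1 /Y2 lerD2l lerN2 ler_pM2l//; have := @Theta_le _ _ (lopt t tt) pht tlt1; lra.
      rewrite /e1 (_ : d * (w t * phi t / d - 1) = w t * phi t - d); last first.
        by rewrite mulrBr dK mulr1.
      have /andP[l0 l1] := lam01 t tt1.
      have : w t * phi t <= w t * (Q t * U t) by rewrite ler_wpM2l.
      have : 0 <= d * (1 - lam t) ^+ 2 by rewrite mulr_ge0 ?sqr_ge0// ltW.
      lra.
    right; split.
      by rewrite /Y1 /Y2 lerD2l lerN2 ler_pM2l//; have := @Theta_le _ _ (lot _ tge0) (ltW pht) pt; lra.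
    have Uz := Uge _ pt; have Ut := U1 t tt1.
    have z0 : 0 <= phase t by rewrite (le_trans tge0)// ltW.
    rewrite /e2 !max_l// in Uz *.
    rewrite (_ : d * (_ / d * _ - _) = w t * phi t * (U (phase t))^-1 - d * (U t)^-1); last first.
      by rewrite mulrBr mulrA dK.
    have Uz0 : 0 < U (phase t) by apply: lt_le_trans Uz.
    have h1 : w t * phi t * (U (phase t))^-1 <= w t * Q t.
      by rewrite ler_pdivrMr// -mulrA ler_wpM2l.
    have h2 : w t * gamma * (U t - 1) <= w t * Q t * (U t - 1).
      by rewrite ler_wpM2r ?subr_ge0// ler_wpM2l// Qgamma.
    have := amgm_rate t tt1; lra.
have {}M : r - d <= Num.max (Y1 t1) (Y2 t1).
  apply: le_trans M; rewrite le_max; apply/orP; left.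
  by rewrite /Y1 C0 A0 /phase F0 !subr0 dK; lra.
have e1p : 0 < 1 - eta by lra.
have [t1eta|t1eta] := leP (1 - eta) t1.
  exists t1; first exact/andP.
  have {}M : r - d <= Y1 t1.
    apply: le_trans M _; rewrite ge_max lexx/=.
    by rewrite /Y1 /Y2 lerD2l lerN2 ler_pM2l// phase1;
      have := @Theta_le _ _ (lot (1 - eta) (ltW e1p)) t1eta t11; lra.
  have A1 : A (1 - eta) <= A t1 by apply: A_nondecreasing => //; lra.
  have : d * (1 - t1) >= 0 by rewrite mulr_ge0 ?(ltW d0)// subr_ge0 ltW.
  by move: M; rewrite /Y1 phase1; lra.
exists (1 - eta); first by apply/andP; split; lra.
have {}M : r - d <= Y2 t1.
  have e1' : 1 - eta < 1 by lra.
  apply: le_trans M _; rewrite ge_max lexx andbT.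
  by rewrite /Y1 /Y2 lerD2l lerN2 ler_pM2l// phase1;
      have := @Theta_le _ _ (lot _ t10) (ltW t1eta) e1'; lra.
(* From [t1] to [1 - eta] the phase is no longer involved: [amgm_rate] alone makes [C - A + d Theta]
   nondecreasing. Since [phase t1 = 1 - eta], the [Theta] term at the right end cancels the one in
   [Y2 t1]. *)
suff : C t1 - A t1 + d * Theta t1 <= C (1 - eta) - A (1 - eta) + d * Theta (1 - eta).
  have : 0 <= d * eta by rewrite mulr_ge0 ?ltW.
  by move: M; rewrite /Y2 phase1; lra.
apply: (@nondecreasing_derive _ (fun t => C t - A t + d * Theta t) (fun t =>
  w t * (Q t * U t) - d * (2 * lam t - lam t ^+ 2) + d * (U (Num.max t 0))^-1)).
- exact: ltW.
- move=> t /andP[t1t te]; have tt1 : 0 <= t < 1 by apply/andP; split; lra.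
  apply: is_deriveD; first by apply: is_deriveB; [exact: DC|exact: DA].
  by apply: is_deriveZ; apply: DTheta; case/andP: tt1 => t0' ->; rewrite lot.
- move=> t /andP[t1t te]; have tt1 : 0 <= t < 1 by apply/andP; split; lra.
  have /andP[tge0 tlt1] := tt1; rewrite max_l//.
  have Ut := U1 t tt1; have wt := w0 t tt1.
  have h2 : w t * gamma * (U t - 1) <= w t * Q t * (U t - 1).
    by rewrite ler_wpM2r ?subr_ge0// ler_wpM2l// Qgamma.
  have h3 : 0 <= w t * Q t.
    have : 0 <= w t * gamma by rewrite wlam// mulr_ge0 ?sqr_ge0// ltW.
    by move=> /le_trans; apply; rewrite ler_wpM2l// Qgamma.
  have := amgm_rate t tt1; lra.
Qed.

End a_priori.

(** * Volterra operator and Tonelli's delayed equation *)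

Section volterra.
Context {R : realType}.
Notation mu := (@lebesgue_measure R).
Implicit Types s t x m h : R.
Variables (p : R) (kappa : R -> R).
Hypothesis p0 : 0 < p.

Notation D := (`[0%R, 1%R[%classic : set R).

Hypothesis ikappa : mu.-integrable D (EFin \o (fun s => (1 - s) `^ p * kappa s)).

(* Freezing t at 1 makes the solutions below continuous on the whole line. *)
Definition vker t s : R := kern (p + 1) (Num.min t 1 - s).

Definition volterra (e : R -> R) t := \int[mu]_(s in D) (vker t s * e s).

(** [kappa] is integrable only with the weight [(1 - s) ^ p]. That weight majorises [vker t] for
    every [t], so dominated convergence works for the whole class, the singular end [t = 1]
    included. *)
Definition admissible (e : R -> R) :=
  measurable_fun D e /\ forall s, D s -> 0 <= e s <= kappa s.

Lemma vker_ge0 t s : 0 <= vker t s. Proof. exact: kern_ge0. Qed.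

Lemma kern_nondecreasing (x y : R) : x <= y -> kern (p + 1) x <= kern (p + 1) y.
Proof.
move=> xy; have [x0|x0] := leP x 0; first by rewrite (kern_le0 _ _ x0) kern_ge0.
have y0 := lt_le_trans x0 xy; rewrite !kernE// addrK.
by apply: ge0_ler_powR => //; rewrite ?nnegrE ltW.
Qed.

Lemma vker_nondecreasing s t t' : t <= t' -> vker t s <= vker t' s.
Proof.
by move=> tt'; apply: kern_nondecreasing; rewrite lerD2r le_min2.
Qed.

Lemma vker_le t s : D s -> vker t s <= (1 - s) `^ p.
Proof.
rewrite /= in_itv/= => /andP[s0 s1].
rewrite -[in leRHS](addrK 1 p) -kernE ?subr_gt0//.
by apply: kern_nondecreasing; rewrite lerD2r ge_min lexx orbT.
Qed.

Lemma measurable_vker t : measurable_fun setT (vker t).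
Proof. exact: measurable_kernB. Qed.

Lemma continuous_vker s : continuous (vker ^~ s).
Proof.
move=> t.
apply: (@continuous_comp _ _ _ (fun t => Num.min t 1 - s) (kern (p + 1))); last first.
  by apply: continuous_kern; rewrite ltrDr.
apply: cvgB; last exact: cvg_cst.
by apply: continuous_min; [exact: cvg_id|exact: cvg_cst].
Qed.

Lemma volterra_dom e t s : admissible e -> D s ->
  `|vker t s * e s| <= (1 - s) `^ p * kappa s.
Proof.
move=> [_ eb] Ds; have /andP[e0 ek] := eb s Ds.
by rewrite ger0_norm ?mulr_ge0 ?vker_ge0// ler_pM ?vker_ge0 ?vker_le.
Qed.

Lemma integrable_volterra e t : admissible e ->
  mu.-integrable D (EFin \o (fun s => vker t s * e s)).
Proof.
move=> ae; have [me eb] := ae.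
apply: (le_integrable _ _ _ ikappa) => //.
- apply/measurable_EFinP; apply: measurable_funM => //.
  by apply: measurable_funTS; exact: measurable_vker.
- move=> s Ds /=; rewrite lee_fin (le_trans (volterra_dom e t s ae Ds))//.
  by rewrite ler_norm.
Qed.

Lemma volterra_continuous e : admissible e -> continuous (volterra e).
Proof.
move=> ae t; have [me eb] := ae.
apply: (@continuity_under_integral _ _ _ mu (fun t s => vker t s * e s) D _ (t - 1) (t + 1) _ _
   (fun s => (1 - s) `^ p * kappa s)) => //.
- by move=> x _; exact: integrable_volterra.
- apply: aeW => s Ds x _; apply: cvgM; last exact: cvg_cst.
  exact: continuous_vker.
- by move=> x _; apply: aeW => s Ds; exact: volterra_dom.
- by rewrite inE/= in_itv/=; apply/andP; split; lra.
Qed.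

Lemma volterra_nondecreasing e t t' : admissible e -> t <= t' ->
  volterra e t <= volterra e t'.
Proof.
move=> ae tt'; have [me eb] := ae; apply: le_Rintegral => //; try exact: integrable_volterra.
by move=> s /eb/andP[e0 _]; rewrite ler_wpM2r// vker_nondecreasing.
Qed.

Lemma volterra_le0 e t : t <= 0 -> volterra e t = 0.
Proof.
move=> t0; rewrite /volterra (@eq_Rintegral _ _ _ _ _ (cst 0)).
  by rewrite Rintegral_cst ?mul0r//; exact: measurable_itv.
move=> s; rewrite inE/= in_itv/= => /andP[s0 s1].
rewrite /vker kern_le0 ?mul0r// subr_le0 (le_trans _ s0)//.
by rewrite ge_min t0.
Qed.

Lemma volterra_min e t : volterra e (Num.min t 1) = volterra e t.
Proof. by rewrite /volterra /vker; apply: eq_Rintegral => s _; rewrite -minA minxx. Qed.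

Lemma volterra_cvg (e_ : nat -> R -> R) e t : (forall n, admissible (e_ n)) ->
  admissible e -> (forall s, D s -> e_ ^~ s @ \oo --> e s) ->
  volterra (e_ n) t @[n --> \oo] --> volterra e t.
Proof.
move=> aen ae ecvg.
have ie := integrable_volterra e t ae.
apply: fine_cvg; rewrite fineK; last exact: integrable_fin_num.
apply: (@dominated_cvg _ _ _ mu D _ (fun n s => (vker t s * e_ n s)%:E) _
  (EFin \o (fun s => (1 - s) `^ p * kappa s))) => //.
- by move=> n; apply: (measurable_int mu); exact: integrable_volterra.
- move=> s Ds; apply: cvg_EFin; first exact: nearW.
  by apply: cvgM; [exact: cvg_cst|exact: ecvg].
- by move=> n s Ds; rewrite lee_fin; exact: volterra_dom.
Qed.

Lemma integral_vker t : 0 <= t <= 1 ->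
  (\int[mu]_(s in D) (vker t s)%:E = ((p + 1)^-1 * t `^ (p + 1))%:E)%E.
Proof.
move=> /andP[t0 t1].
have p1 : 0 < p + 1 by rewrite addr_gt0.
have -> : (p + 1)^-1 * t `^ (p + 1) = (p + 1)^-1 * kern (p + 1 + 1) t.
  congr (_ * _); have [t0'|t0'] := ltP 0 t; first by rewrite kernE// addrK.
  have -> : t = 0 by apply/eqP; rewrite eq_le t0 t0'.
  by rewrite kern_le0// powR0// gt_eqF.
rewrite EFinM.
have -> : ((p + 1)^-1)%:E = ebeta (p + 1) 1.
  rewrite EFin_ebeta// Gamma1 mulr1 [p + 1 + 1]addrC GammaDl//.
  by congr EFin; rewrite invfM mulrCA mulfV ?mulr1// gt_eqF// Gamma_gt0.
rewrite -integral_kern_conv -integral_itv_obnd_cbnd; last first.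
  by apply/measurable_funTS/measurable_EFinP; exact: measurable_vker.
rewrite integral_mkcond; apply: eq_integral => s _.
rewrite patchE mem_setE in_itv/= /vker min_l//.
have [s0|s0] := ltP 0 s; last by rewrite (kern_le0 1)// mulr0.
have [s1|s1] := ltP s 1; first by rewrite kern1// mulr1.
by rewrite kern_le0 ?mul0r// subr_le0 (le_trans t1).
Qed.

Lemma integrable_vker t : 0 <= t <= 1 -> mu.-integrable D (EFin \o vker t).
Proof.
move=> t01; apply/integrableP; split.
  by apply/measurable_EFinP/measurable_funTS; exact: measurable_vker.
under eq_integral do rewrite /= ger0_norm ?vker_ge0//.
by rewrite integral_vker// ltry.
Qed.

(** Source of the profile [1 - t ^ mu]: the difference of the two kernels is nonnegative, so [e] may
    be replaced by its lower bound, and the kernels integrate explicitly. *)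
Lemma volterra_increment (e : R -> R) (g : R) t : admissible e -> 0 <= g ->
  (forall s, D s -> g <= e s) -> 0 <= t <= 1 ->
  g * (p + 1)^-1 * (1 - t `^ (p + 1)) <= volterra e 1 - volterra e t.
Proof.
move=> ae g0 ge t01; have [me eb] := ae.
have t11 : 0 <= (1 : R) <= 1 by rewrite ler01 lexx.
rewrite /volterra -RintegralB//; try exact: integrable_volterra.
have -> : g * (p + 1)^-1 * (1 - t `^ (p + 1)) =
    \int[mu]_(s in D) (g * (vker 1 s - vker t s)).
  rewrite RintegralZl//; last first.
    rewrite (_ : _ \o _ = (EFin \o vker 1%R) \- (EFin \o vker t))%E; last first.
      by apply/funext => s.
    by apply: integrableB => //; exact: integrable_vker.
  rewrite RintegralB//; try exact: integrable_vker.
  by rewrite /Rintegral !integral_vker//= powR1; ring.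
apply: le_Rintegral => //.
- rewrite (_ : _ \o _ = (fun s => g%:E * ((EFin \o vker 1%R) \- (EFin \o vker t)) s)%E); last first.
    by apply/funext => s.
  by apply: integrableZl => //; apply: integrableB => //; exact: integrable_vker.
- rewrite (_ : _ \o _ = (EFin \o (fun s => (vker 1 s * e s)%R)) \-
      (EFin \o (fun s => (vker t s * e s)%R)))%E.
    by apply: integrableB => //; exact: integrable_volterra.
  by apply/funext => s.
- move=> s Ds; rewrite -mulrBl mulrC ler_wpM2l ?ge//.
  by rewrite subr_ge0 vker_nondecreasing//; case/andP: t01.
Qed.

(** Both kernels vanish for [s >= t], so a bound on [e] before [t] suffices even if [kappa] blows up
    at 1. *)
Lemma volterra_modulus (e : R -> R) (M : R) t t' : admissible e -> 0 <= M ->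
  (forall s, 0 <= s < t -> e s <= M) -> 0 <= t' -> t' <= t -> t <= 1 ->
  volterra e t - volterra e t' <= M * (p + 1)^-1 * (t `^ (p + 1) - t' `^ (p + 1)).
Proof.
move=> ae M0 eM t'0 tt' t1; have [me eb] := ae.
have t01 : 0 <= t <= 1 by rewrite (le_trans t'0).
have t01' : 0 <= t' <= 1 by rewrite t'0 (le_trans tt').
have iv : mu.-integrable D ((EFin \o vker t) \- (EFin \o vker t'))%E.
  by apply: integrableB => //; exact: integrable_vker.
rewrite /volterra -RintegralB//; try exact: integrable_volterra.
have -> : M * (p + 1)^-1 * (t `^ (p + 1) - t' `^ (p + 1)) =
    \int[mu]_(s in D) (M * (vker t s - vker t' s)).
  rewrite RintegralZl//.
  rewrite RintegralB//; try exact: integrable_vker.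
  by rewrite /Rintegral !integral_vker//=; ring.
apply: le_Rintegral => //.
- rewrite (_ : _ \o _ = (EFin \o (fun s => (vker t s * e s)%R)) \-
      (EFin \o (fun s => (vker t' s * e s)%R)))%E.
    by apply: integrableB => //; exact: integrable_volterra.
  by apply/funext => s.
- rewrite (_ : _ \o _ = (fun s => M%:E * ((EFin \o vker t) \- (EFin \o vker t')) s)%E); last first.
    by apply/funext => s.
  exact: integrableZl.
- move=> s; rewrite /= in_itv/= => /andP[s0 s1]; rewrite -mulrBl mulrC.
  have [st|ts] := ltP s t.
    by apply: ler_wpM2r; [rewrite subr_ge0 vker_nondecreasing|apply: eM; rewrite s0].
  by rewrite /vker !kern_le0 ?subrr ?mulr0// subr_le0 ge_min ?ts// (le_trans tt' ts).
Qed.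

End volterra.

Section tonelli.
Context {R : realType}.
Notation mu := (@lebesgue_measure R).
Implicit Types (s t x m h : R) (y : R -> R).
Variables (p : R) (kappa : R -> R) (G g : R) (N : R -> R -> R).
Hypotheses (p0 : 0 < p) (G0 : 0 < G) (g0 : 0 < g).

Notation D := (`[0%R, 1%R[%classic : set R).

Hypothesis ikappa : mu.-integrable D (EFin \o (fun s => (1 - s) `^ p * kappa s)).
Hypothesis cN : forall y : R -> R, continuous y ->
  forall s, -1 < s < 1 -> {for s, continuous (fun s => N s (y s))}.
Hypothesis cNx : forall s, 0 <= s < 1 -> continuous (N s).
Hypothesis Nb : forall s x, 0 <= s < 1 -> g <= N s x <= kappa s.

Definition delayed h (y : R -> R) s := N s (y (s - h)).

Definition tonelli_step h m (y : R -> R) t := m - volterra p (delayed h y) t / G.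

Definition tonelli_iter h m i := iter i (tonelli_step h m) (fun=> m).

Lemma continuous_delayed h y s : continuous y -> -1 < s < 1 ->
  {for s, continuous (delayed h y)}.
Proof.
move=> cy s1; apply: (@cN (fun s => y (s - h))) => // t.
apply: (@continuous_comp _ _ _ (fun t => t - h) y); last exact: cy.
by apply: cvgB; [exact: cvg_id|exact: cvg_cst].
Qed.

Lemma admissible_delayed h y : continuous y -> admissible kappa (delayed h y).
Proof.
move=> cy; split; last first.
  move=> s; rewrite /= in_itv/= => s01; have /andP[gN Nk] := Nb s (y (s - h)) s01.
  by rewrite Nk andbT (le_trans _ gN)// ltW.
have m1 : measurable_fun (`]-1, 1[%classic : set R) (delayed h y).
  apply: open_continuous_measurable_fun; first exact: interval_open.
  by move=> s; rewrite inE/= in_itv/= => s1; exact: continuous_delayed.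
apply: measurable_funS m1; first exact: measurable_itv.
by apply: subset_itvr; rewrite bnd_simp ltrN10.
Qed.

Lemma continuous_tonelli h m i : continuous (tonelli_iter h m i).
Proof.
elim: i => [|i IH] t; first exact: cvg_cst.
apply: cvgB; first exact: cvg_cst.
apply: cvgM; last exact: cvg_cst.
by apply: (volterra_continuous _ _ p0 ikappa); exact: admissible_delayed.
Qed.

(* The delay makes the i-th iterate exact up to time i h. *)
Lemma tonelli_iter_stable h m i t : 0 < h -> t <= i%:R * h ->
  tonelli_iter h m i.+1 t = tonelli_iter h m i t.
Proof.
move=> h0; elim: i t => [|i IH] t tih.
  rewrite mul0r in tih.
  by rewrite /tonelli_iter/= /tonelli_step volterra_le0// mul0r subr0.
rewrite [LHS]/(tonelli_step h m (tonelli_iter h m i.+1) t).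
rewrite [RHS]/(tonelli_step h m (tonelli_iter h m i) t).
rewrite /tonelli_step; congr (_ - _ / _); apply: eq_Rintegral => s _.
have [st|st] := ltP s t; last first.
  by rewrite /vker kern_le0 ?mul0r// subr_le0 (le_trans _ st)// ge_min lexx.
rewrite /delayed IH// lerBlDr (le_trans (ltW st))// (le_trans tih)//.
by rewrite -natr1 mulrDl mul1r.
Qed.

Lemma tonelli_iter_min h m i t :
  tonelli_iter h m i (Num.min t 1) = tonelli_iter h m i t.
Proof.
case: i => [//|i].
rewrite [LHS]/(tonelli_step h m (tonelli_iter h m i) (Num.min t 1)).
rewrite [RHS]/(tonelli_step h m (tonelli_iter h m i) t).
by rewrite /tonelli_step (volterra_min p (delayed h (tonelli_iter h m i)) t).
Qed.

(** [n] delays cover [[0, 1]], and beyond 1 the iterates are frozen. *)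
Lemma tonelli_fixed h m n : 0 < h -> 1 <= n%:R * h ->
  tonelli_iter h m n.+1 = tonelli_iter h m n.
Proof.
move=> h0 nh; apply/funext => t; rewrite -[LHS]tonelli_iter_min -[RHS]tonelli_iter_min.
by apply: tonelli_iter_stable => //; apply: le_trans nh; rewrite ge_min lexx orbT.
Qed.

(** Continuity in [m] passes from one iterate to the next by dominated convergence. The solution
    being an iterate of fixed index, this is the continuous dependence behind the shooting. *)
Lemma continuous_tonelli_init h i t : continuous (fun m => tonelli_iter h m i t).
Proof.
elim: i t => [|i IH] t m; first exact: cvg_id.
apply: cvgB; first exact: cvg_id.
apply: cvgM; last exact: cvg_cst.
apply/(@cvg_nbhsP _ R^o) => u um.
apply: (volterra_cvg _ _ p0 ikappa) => //.
- by move=> n; apply: admissible_delayed; exact: continuous_tonelli.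
- by apply: admissible_delayed; exact: continuous_tonelli.
- move=> s; rewrite /= in_itv/= => s01.
  have cm : {for m, continuous (fun m => delayed h (tonelli_iter h m i) s)}.
    apply: (@continuous_comp _ _ _ (fun m => tonelli_iter h m i (s - h)) (N s)).
      exact: IH.
    exact: cNx.
  by move/(@cvg_nbhsP _ R^o) : cm; exact.
Qed.

Definition tonelli n m := tonelli_iter n.+1%:R^-1 m n.+1.

Lemma tonelliE n m t :
  tonelli n m t = m - volterra p (delayed n.+1%:R^-1 (tonelli n m)) t / G.
Proof.
by rewrite {1}/tonelli -tonelli_fixed// mulfV.
Qed.

Lemma continuous_tonelli_sol n m : continuous (tonelli n m).
Proof. exact: continuous_tonelli. Qed.

Lemma admissible_tonelli n m : admissible kappa (delayed n.+1%:R^-1 (tonelli n m)).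
Proof. by apply: admissible_delayed; exact: continuous_tonelli_sol. Qed.

Lemma tonelli_nonincreasing n m t t' : t <= t' -> tonelli n m t' <= tonelli n m t.
Proof.
move=> tt'; rewrite !tonelliE lerD2l lerN2.
have : volterra p (delayed n.+1%:R^-1 (tonelli n m)) t <=
    volterra p (delayed n.+1%:R^-1 (tonelli n m)) t'.
  by apply: (volterra_nondecreasing _ _ p0 ikappa _ _ _ _ tt'); exact: admissible_tonelli.
by move: (volterra _ _ t) (volterra _ _ t') => V V' VV'; rewrite ler_pM2r ?invr_gt0.
Qed.

Lemma tonelli_le0 n m t : t <= 0 -> tonelli n m t = m.
Proof. by move=> t0; rewrite tonelliE volterra_le0// mul0r subr0. Qed.

Lemma tonelli_increment n m t : 0 <= t <= 1 ->
  g * (p + 1)^-1 * (1 - t `^ (p + 1)) / G <= tonelli n m t - tonelli n m 1.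
Proof.
move=> t01; rewrite !tonelliE.
have ge s : D s -> g <= delayed n.+1%:R^-1 (tonelli n m) s.
  rewrite /= in_itv/= => s01.
  by have /andP[] := Nb s (tonelli n m (s - n.+1%:R^-1)) s01.
have := volterra_increment _ _ p0 ikappa _ _ t (admissible_tonelli n m) (ltW g0) ge t01.
move: (volterra p _ t) (volterra p _ 1) => V1 V2 V12.
rewrite (_ : _ - (_ - _) = (V2 - V1) / G); last by ring.
by rewrite ler_pM2r ?invr_gt0.
Qed.

Lemma tonelli_shooting n r : 0 < r -> 0 < tonelli n r 1 ->
  exists2 m, 0 <= m <= r & tonelli n m 1 = 0.
Proof.
move=> r0 H1.
have H0 : tonelli n 0 1 <= 0.
  have := tonelli_nonincreasing n 0 0 1 ler01.
  by rewrite (tonelli_le0 n 0 0 (lexx 0)).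
have cf : {within `[0, r], continuous (fun m => tonelli n m 1)}.
  by apply: continuous_subspaceT => m; exact: continuous_tonelli_init.
have v0 : Num.min (tonelli n 0 1) (tonelli n r 1) <= 0 <= Num.max (tonelli n 0 1) (tonelli n r 1).
  move: (tonelli n 0 1) (tonelli n r 1) H0 H1 => a b a0 b0.
  by rewrite ge_min a0/= le_max (ltW b0) orbT.
have [m mr m1] := @IVT R _ 0 r 0 (ltW r0) cf v0.
by exists m => //; rewrite in_itv/= in mr.
Qed.

End tonelli.

(** * The barrier of the a priori estimate and the origin of 5/6 *)

Section barrier.
Context {R : realType}.
Implicit Types t : R.
Variables (m d : R).
Hypotheses (m1 : 1 < m) (m2 : m <= 2) (d0 : 0 < d).

(** The [lam] with [w gamma = d lam ^ 2] for [w = (1 - t) ^ (m - 1) / Gamma m] and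
    [d = 2 gamma / Gamma (m + 1)], because [Gamma (m + 1) = m Gamma m]. *)
Definition rate t : R := Num.sqrt (m / 2) * (1 - t) `^ ((m - 1) / 2).

(** The primitive of [d (2 rate - rate ^ 2)] that vanishes at 0. *)
Definition barrier t : R :=
  d * (4 * Num.sqrt (m / 2) / (m + 1) * (1 - (1 - t) `^ ((m + 1) / 2))
       - 2^-1 * (1 - (1 - t) `^ m)).

Lemma rate_ge0 t : 0 <= rate t.
Proof. by rewrite mulr_ge0 ?sqrtr_ge0 ?powR_ge0. Qed.

Lemma sqr_rate t : 0 <= t < 1 -> rate t ^+ 2 = m / 2 * (1 - t) `^ (m - 1).
Proof.
move=> /andP[t0 t1]; rewrite /rate exprMn sqr_sqrtr; last by move: m1; lra.
rewrite -[X in _ * X]powR_mulrn ?powR_ge0// -powRrM; congr (_ * _ `^ _).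
by field.
Qed.

Lemma rate_le1 t : 0 <= t < 1 -> rate t <= 1.
Proof.
move=> /andP[t0 t1]; rewrite -[leRHS]mul1r /rate ler_pM ?sqrtr_ge0 ?powR_ge0//.
  by rewrite -[leRHS]sqrtr1 ler_sqrt//; move: m2; lra.
rewrite -[leRHS](powRr0 (1 - t)) ger_powR//; first by apply/andP; split; lra.
by move: m1; lra.
Qed.

Lemma is_derive_powR_onem (a t : R) : t < 1 ->
  is_derive t 1 (fun t => (1 - t) `^ a) (- (a * (1 - t) `^ (a - 1))).
Proof.
move=> t1; have t0 : 0 < 1 - t by rewrite subr_gt0.
have D : is_derive t 1 (fun t => 1 - t) (0 - 1) by exact: is_deriveB.
have E : is_derive t 1 (fun t => (1 - t) `^ a) (a * (1 - t) `^ (a - 1) * (0 - 1)).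
  exact: (@is_derive1_comp R (fun x => x `^ a) (fun t => 1 - t) t _ _ (is_derive1_powR a t0) D).
by apply: (is_derive_eq E); rewrite sub0r mulrN1.
Qed.

Lemma is_derive_barrier t : 0 <= t < 1 ->
  is_derive t 1 barrier (d * (2 * rate t - rate t ^+ 2)).
Proof.
move=> t01; have /andP[t0 t1] := t01.
have D1 := is_deriveB (is_derive_cst (1 : R) t 1) (is_derive_powR_onem ((m + 1) / 2) t t1).
have D2 := is_deriveB (is_derive_cst (1 : R) t 1) (is_derive_powR_onem m t t1).
have D := is_deriveZ d (is_deriveB (is_deriveZ (4 * Num.sqrt (m / 2) / (m + 1)) D1) (is_deriveZ 2^-1 D2)).
apply: (is_derive_eq D); rewrite !sub0r !opprK sqr_rate// /rate.
rewrite -![_ *: _]/(_ * _); congr (_ * _).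
rewrite (_ : (m + 1) / 2 - 1 = (m - 1) / 2); last by field.
have mp : m + 1 != 0 by rewrite gt_eqF//; move: m1; lra.
by field.
Qed.

Lemma barrier0 : barrier 0 = 0.
Proof. by rewrite /barrier subr0 !powR1 subrr !mulr0 subr0 mulr0. Qed.

(** [5/6 = 4/3 - 1/2], where [4/3] is the least value of [c], reached at [m = 2]. In [7/3], the part
    [4/3] comes from [eta ^ ((m + 1) / 2) <= eta] and the part 1 from the subtracted [d eta]. *)
Lemma barrier_ge (eta : R) : 0 < eta < 1 ->
  d * (5 / 6 - 7 / 3 * eta) <= barrier (1 - eta) - d * eta.
Proof.
move=> /andP[e0 e1].
set c := 4 * Num.sqrt (m / 2) / (m + 1).
have c43 : 4 / 3 <= c.
  have t2 : Num.sqrt (m / 2) ^+ 2 = m / 2 by rewrite sqr_sqrtr//; move: m1; lra.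
  have t0 := sqrtr_ge0 (m / 2).
  have mp : 0 < m + 1 by move: m1; lra.
  rewrite /c ler_pdivlMr//; set s := Num.sqrt (m / 2) in t2 t0 *.
  have s1 : s <= 1 by rewrite -[leRHS]sqrtr1 ler_sqrt//; move: m2; lra.
  have s2 : 2^-1 <= s.
    rewrite leNgt; apply/negP => s2.
    have : s ^+ 2 < 2^-1 by nra.
    by rewrite t2; move: m1; lra.
  (* Since [m = 2 s ^ 2], the claim [4/3 (m + 1) <= 4 s] is this inequality up to a positive
     factor. *)
  have : (2 * s - 1) * (s - 1) <= 0 by nra.
  by move: t2; nra.
rewrite /barrier -/c subKr.
have h1 : eta `^ ((m + 1) / 2) <= eta.
  by rewrite -[leRHS](powRr1 (ltW e0)) ger_powR ?e0 ?(ltW e1)//; move: m1; lra.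
have h2 : 0 <= eta `^ m by exact: powR_ge0.
rewrite -mulrBr ler_pM2l//.
have h3 : 4 / 3 * (1 - eta) <= c * (1 - eta `^ ((m + 1) / 2)).
  by apply: ler_pM => //; lra.
lra.
Qed.

End barrier.

(** * Primitives on open intervals *)

Section primitive.
Context {R : realType}.
Notation mu := (@lebesgue_measure R).

Lemma is_derive_primitive (h : R -> R) (lo hi c t : R) :
  (forall s, lo < s < hi -> {for s, continuous h}) ->
  lo < c -> c < t -> t < hi ->
  is_derive t 1 (fun x => \int[mu]_(u in `[c, x]) h u) (h t).
Proof.
move=> ch loc ct thi.
pose u := (t + hi) / 2.
have tu : t < u by rewrite /u; lra.
have uhi : u < hi by rewrite /u; lra.
have ih : mu.-integrable `[c, u] (EFin \o h).
  apply: continuous_compact_integrable; first exact: segment_compact.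
  apply: continuous_in_subspaceT => x; rewrite inE/= in_itv/= => /andP[cx xu].
  by apply: ch; apply/andP; split; lra.
have tc : {for t, continuous h} by apply: ch; apply/andP; split; lra.
have [dF F'] := @continuous_FTC1_closed _ h c t u tu ih ct tc.
by split; rewrite -?derive1E.
Qed.

(** The interval begins left of 0 so that [H] has a two-sided derivative at 0, as the a priori
    estimate demands; the base point [lo / 2] keeps the integrals away from the end [lo]. *)
Lemma primitive_exists (h : R -> R) (lo hi : R) :
  lo < 0 -> (forall s, lo < s < hi -> {for s, continuous h}) ->
  exists H : R -> R, [/\ H 0 = 0, (forall t, lo / 2 < t < hi -> is_derive t 1 H (h t)) &
    forall t, 0 <= t < hi -> H t = \int[mu]_(u in `[0, t]) h u].
Proof.
move=> lo0 ch.
pose K x := \int[mu]_(u in `[lo / 2, x]) h u.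
exists (fun x => K x - K 0); split; first by rewrite subrr.
  move=> t /andP[lot thi].
  have D : is_derive t 1 K (h t).
    by apply: (is_derive_primitive _ lo hi) => //; lra.
  by have := is_deriveB D (is_derive_cst (K 0) t 1); rewrite subr0.
move=> t /andP[t0 thi].
have ih : mu.-integrable `[lo / 2, t] (EFin \o h).
  apply: continuous_compact_integrable; first exact: segment_compact.
  apply: continuous_in_subspaceT => x; rewrite inE/= in_itv/= => /andP[cx xu].
  by apply: ch; apply/andP; split; lra.
rewrite /K Rintegral_itvB//; last by rewrite bnd_simp; lra.
rewrite Rintegral_itv_obnd_cbnd//.
apply: integrableS ih; [exact: measurable_itv|exact: measurable_itv|].
by apply: subset_itvr; rewrite bnd_simp; lra.
Qed.

End primitive.

(** * Limits by compactness and monotonicity *)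

Section selection.
Context {R : realType}.
Implicit Types (t s : R) (k n : nat).

(** A product over all reals is not metrisable: Tychonoff's theorem gives a cluster point rather
    than a convergent subsequence. A basic neighbourhood sees finitely many coordinates, hence the
    finite families [g]. *)
Lemma cluster_selection (X_ : nat -> R -> R) (r : R) :
  (forall n t, 0 <= X_ n t <= r) ->
  exists X : R -> R, forall (k : nat) (g : 'I_k -> R) (N : nat) (e : R), 0 < e ->
    exists2 n, (N <= n)%N & forall i : 'I_k, `|X_ n (g i) - X (g i)| < e.
Proof.
move=> Xr.
pose T := prod_topology (fun _ : R => R).
have tyc := @tychonoff R (fun=> R) (fun=> `[0, r]%classic) (fun=> @segment_compact R 0 r).
pose F : set_system T := (X_ : nat -> T) @ \oo.
have FF : ProperFilter F by exact: fmap_proper_filter.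
have [|X [_ clX]] := tyc F FF.
  by exists 0%N => // n _ i; rewrite /= in_itv/= Xr.
exists X => k g N e e0.
have B : nbhs (X : T) [set f : T | forall i : 'I_k, `|f (g i) - X (g i)| < e].
  apply: (@filter_forall T 'I_k (fun i => [set f : T | `|f (g i) - X (g i)| < e]) (nbhs (X : T))) => i.
  have hb : nbhs (X (g i) : R) [set y | `|y - X (g i)| < e].
    by apply/nbhs_ballP; exists e => // y; rewrite /ball/= distrC.
  exact: (@proj_continuous R (fun=> R) (g i) X _ hb).
have A : F [set f : T | exists2 n, (N <= n)%N & f = X_ n].
  by exists N => // n /= Nn; exists n.
have [f [[n Nn ->] Xn]] := clX _ _ A B.
by exists n.
Qed.

(** By monotonicity [Z_ k (s_ k)] lies between the values at the two grid points around [s_ k].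
    These are close to values of [X], and so to [X s] by continuity. The arguments may move with [k]
    because the delay moves them. *)
Lemma monotone_grid_cvg (Z_ : nat -> R -> R) (X : R -> R) (s : R) (s_ : nat -> R) :
  (forall k t t', t <= t' -> Z_ k t' <= Z_ k t) ->
  (forall k i, (i <= k.+1)%N ->
    `|Z_ k (i%:R / k.+1%:R) - X (i%:R / k.+1%:R)| < k.+1%:R^-1) ->
  0 <= s < 1 ->
  (forall e, 0 < e -> exists2 dl, 0 < dl &
    forall t, 0 <= t < 1 -> `|t - s| < dl -> `|X t - X s| < e) ->
  (forall k, 0 <= s_ k) -> s_ @ \oo --> s -> (fun k => Z_ k (s_ k)) @ \oo --> X s.
Proof.
move=> Zmono Zgrid /andP[s0 s1] cX s_0 s_s.
apply/cvgrPdist_lt => e e0.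
have e20 : 0 < e / 2 by rewrite divr_gt0.
have [dl dl0 Hdl] := cX (e / 2) e20.
(* The second bound keeps both grid points around [s_ k] below 1, where [X] is controlled. *)
pose dl' := Num.min (dl / 2) ((1 - s) / 2).
have dl'0 : 0 < dl' by rewrite lt_min !divr_gt0// subr_gt0.
have dl'1 : dl' <= dl / 2 by rewrite ge_min lexx.
have dl'2 : dl' <= (1 - s) / 2 by rewrite ge_min lexx orbT.
have harm : @harmonic R @ \oo --> (0 : R) by exact: cvg_harmonic.
near=> k.
have h1 : `|s_ k - s| < dl' by near: k; move/cvgr_distC_lt : s_s; exact.
have h2 : k.+1%:R^-1 < dl' :> R.
  by near: k; exact: (cvgr_lt _ harm).
have h3 : k.+1%:R^-1 < e / 2 :> R.
  by near: k; exact: (cvgr_lt _ harm).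
set K := k.+1%:R : R in h2 h3 *.
have K0 : 0 < K by rewrite ltr0n.
have /andP[i1 i2] := truncn_itv (mulr_ge0 (s_0 k) (ltW K0)).
set i := Num.truncn _ in i1 i2.
rewrite -ler_pdivrMr// in i1; rewrite -ltr_pdivlMr// in i2.
have hs1 : s_ k < 1 by move: h1; rewrite ltr_norml => /andP[_]; lra.
have ik : (i <= k)%N.
  rewrite -ltnS -(ltr_nat R) -/K -[ltRHS]mul1r -ltr_pdivrMr//.
  exact: le_lt_trans hs1.
have i3 : i.+1%:R / K = i%:R / K + K^-1 by rewrite -natr1 mulrDl mul1r.
have g1 := Zgrid k i (leq_trans ik (leqnSn k)); rewrite -/K in g1.
have g2 := Zgrid k i.+1 ik; rewrite -/K in g2.
have m1 := Zmono k _ _ i1; have m2 := Zmono k _ _ (ltW i2).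
have gr0 : 0 <= i%:R / K by rewrite divr_ge0// ltW.
move: i1 i2 h1 gr0; rewrite i3 in g2 m2 *; set a := i%:R / K in g1 g2 m1 m2 *.
set b := K^-1 in h2 h3 g1 g2 m2 *; rewrite ltr_norml => a1 a2 /andP[h4 h5] gr0.
have b0 : 0 < b by rewrite invr_gt0.
have c1 : `|X a - X s| < e / 2.
  by apply: Hdl; [apply/andP; split; lra|rewrite ltr_norml; apply/andP; split; lra].
have c2 : `|X (a + b) - X s| < e / 2.
  by apply: Hdl; [apply/andP; split; lra|rewrite ltr_norml; apply/andP; split; lra].
move: c1 c2 g1 g2; rewrite !ltr_norml => /andP[? ?] /andP[? ?] /andP[? ?] /andP[? ?].
by apply/andP; split; lra.
Unshelve. all: end_near. Qed.

End selection.

(** * Solving the integral equation *)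

Lemma ler_average {R : realType} (e a b w : R) : e <= a * w -> e <= b * w -> e <= (a + b) / 2 * w.
Proof. lra. Qed.

Lemma ler_of_growth {R : realType} (r y a b dl dz : R) :
  r - y <= a -> a <= b -> b <= r - dl + dz -> dl - dz <= y.
Proof. lra. Qed.

Lemma ler_of_level {R : realType} (r y a F dl eta : R) :
  r - y <= a -> a <= F -> y < dl * eta -> (1 - eta) * dl <= F - (r - dl).
Proof. by move=> ? ? ?; rewrite mulrBl [eta * _]mulrC; lra. Qed.

Lemma ler_of_approx {R : realType} (a b K : R) :
  (forall e : R, 0 < e -> exists x y : R, [/\ `|x - a| < e, `|y - b| < e, y <= x & x - y <= K]) ->
  b <= a /\ a - b <= K.
Proof.
move=> H; split; apply/ler_addgt0Pr => e e0; have e20 : 0 < e / 2 by rewrite divr_gt0.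
  have [x [y [+ + xy _]]] := H _ e20; rewrite !ltr_norml => /andP[_ ?] /andP[? _]; lra.
have [x [y [+ + _ xy]]] := H _ e20; rewrite !ltr_norml => /andP[? _] /andP[_ ?]; lra.
Qed.

(** As [eta] tends to 0 the left side tends to [r - dl / 6], which exceeds [5/6 r] because
    [dl < r]. *)
Lemma ler_of_all_eta {R : realType} (B r dl : R) : 0 < dl -> dl < r ->
  (forall eta : R, 0 < eta < 1 -> r - dl + dl * (5 / 6 - 7 / 3 * eta) <= B) -> 5 / 6 * r <= B.
Proof.
move=> d0 dr H; rewrite leNgt; apply/negP => Br.
pose eps := 5 / 6 * r - B.
have eps0 : 0 < eps by rewrite subr_gt0.
pose eta := Num.min (1 / 2) (eps / (3 * dl)).
have eta0 : 0 < eta by rewrite lt_min !divr_gt0// mulr_gt0.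
have eta1 : eta <= 1 / 2 by rewrite ge_min lexx.
have eta2 : eta * (3 * dl) <= eps by rewrite -ler_pdivlMr ?mulr_gt0// ge_min lexx orbT.
have e01 : 0 < eta < 1 by rewrite eta0/=; lra.
have := H eta e01; have : 0 <= dl * eta by rewrite mulr_ge0 ?ltW.
by rewrite /eps in eta2; lra.
Qed.

Section bvp.
Context {R : realType}.
Notation leb := (@lebesgue_measure R).
Implicit Types (t s x y : R).
Variables (mu : R) (f : R -> R -> R) (q u v gamma : R -> R) (rho : R).
Hypotheses (mu_gt1 : 1 < mu) (mu_le2 : mu <= 2).
Hypothesis f_cont : {within `]-1, 1[ `*` `]0, +oo[,
               continuous (fun p : R * R => f p.1 p.2)}.
Hypothesis f_even : forall x t : R, 0 < x -> -1 < t < 1 -> f t x = f (- t) x.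
Hypothesis q_cont : {within `]-1, 1[, continuous q}.
Hypothesis u_cont : {within `]0, +oo[, continuous u}.
Hypothesis u_decr : forall x y : R, 0 < x -> x <= y -> u y <= u x.
Hypothesis v_incr : forall x y : R, 0 <= x -> x <= y -> v x <= v y.
Hypothesis f_bound : forall t x : R, -1 < t < 1 -> 0 < x -> `|f t x| <= q t * (u x + v x).
Hypothesis q_int : (\int[lebesgue_measure]_(t in `](-1)%R, 1%R[)
              ((1 - `|t|) `^ (mu - 1) * q t)%R%:E < +oo)%E.
Hypothesis qu_int : forall c : R, 0 < c ->
     (\int[lebesgue_measure]_(t in `](-1)%R, 1%R[)
        ((1 - `|t|) `^ (mu - 1) * q t * u (c * (1 - `|t| `^ mu)))%R%:E < +oo)%E.
Hypothesis gamma_gt0 : forall r : R, 0 < r -> 0 < gamma r.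
Hypothesis rho_gt0 : 0 < rho.
Hypothesis rho_gt : rho > 2 * gamma rho / Gamma (mu + 1).
Hypothesis f_ge : forall t x : R, -1 < t < 1 -> 0 < x <= rho -> gamma rho <= f t x.
Hypotheses (u_rho : 0 < u rho) (v_rho : 0 <= v rho).
Hypothesis chi_lt : rho / (chi mu q u gamma rho * (1 + v rho / u rho)) > 1.

Notation p := (mu - 1).
Notation G := (Gamma mu).
Definition level : R := 2 * gamma rho / Gamma (mu + 1).
Notation d := level.
Notation D := (`[0%R, 1%R[%classic : set R).

Definition floor t : R := gamma rho / Gamma (mu + 1) * (1 - `|t| `^ mu).

Definition truncated s x : R := f s (Num.min rho (Num.max x (floor s))).

Definition dominant s : R := q s * (u (floor s) + v rho).

Lemma p_gt0 : 0 < p. Proof. by rewrite subr_gt0. Qed.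

Lemma mu_gt0 : 0 < mu. Proof. exact: lt_trans ltr01 mu_gt1. Qed.

Lemma G_gt0 : 0 < G. Proof. by rewrite Gamma_gt0// mu_gt0. Qed.

Lemma GammaDr : Gamma (mu + 1) = mu * G.
Proof. by rewrite addrC GammaDl// mu_gt0. Qed.

Lemma Gamma1_gt0 : 0 < Gamma (mu + 1).
Proof. by rewrite GammaDr mulr_gt0 ?mu_gt0 ?G_gt0. Qed.

Lemma d_gt0 : 0 < d.
Proof. by rewrite divr_gt0 ?Gamma1_gt0// mulr_gt0// gamma_gt0. Qed.

Lemma half_d : gamma rho / Gamma (mu + 1) = d / 2.
Proof. by rewrite /level [RHS]mulrAC [2 * _]mulrC mulfK. Qed.

Lemma d_lt_rho : d < rho. Proof. exact: rho_gt. Qed.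

Lemma f_cont_at t x : -1 < t < 1 -> 0 < x ->
  {for (t, x), continuous (fun p : R * R => f p.1 p.2)}.
Proof.
move=> t1 x0.
have oA : open (`]-1, 1[ `*` `]0, +oo[ : set (R * R)).
  rewrite openE => -[a b] [/= a1 b0].
  exists (`]-1, 1[%classic, `]0, +oo[%classic) => //=.
  by split; apply: open_nbhs_nbhs; split => //; exact: interval_open.
have := f_cont; rewrite continuous_open_subspace//; apply.
by rewrite inE/=; split; rewrite /= in_itv/= ?andbT.
Qed.

Lemma q_cont_at t : -1 < t < 1 -> {for t, continuous q}.
Proof.
move=> t1; have := q_cont; rewrite continuous_open_subspace; last exact: interval_open.
by apply; rewrite inE/= in_itv.
Qed.

Lemma u_cont_at x : 0 < x -> {for x, continuous u}.
Proof.
move=> t1; have := u_cont; rewrite continuous_open_subspace; last exact: interval_open.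
by apply; rewrite inE/= in_itv/= andbT.
Qed.

Lemma continuous_norm_powR : continuous (fun t => `|t| `^ mu).
Proof.
have -> : (fun t => `|t| `^ mu) = (fun t => kern (mu + 1) `|t|).
  apply/funext => t; have [->|t0] := eqVneq t 0.
    by rewrite normr0 kern_le0// powR0// gt_eqF// mu_gt0.
  by rewrite kernE ?normr_gt0// addrK.
move=> t; apply: (@continuous_comp _ _ _ (fun t => `|t|) (kern (mu + 1))).
  exact: norm_continuous.
by apply: continuous_kern; rewrite ltrDr mu_gt0.
Qed.

Lemma profile_bounds t : -1 < t < 1 -> 0 < 1 - `|t| `^ mu <= 1.
Proof.
move=> t1; rewrite lerBlDr lerDl powR_ge0 andbT subr_gt0.
have t1' : `|t| < 1 by rewrite ltr_norml.
rewrite [ltRHS](_ : _ = 1 `^ mu); last by rewrite powR1.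
by rewrite gt0_ltr_powR ?nnegrE ?mu_gt0.
Qed.

Lemma continuous_floor : continuous floor.
Proof.
move=> t; apply: cvgM; first exact: cvg_cst.
by apply: cvgB; [exact: cvg_cst|exact: continuous_norm_powR].
Qed.

Lemma floor_gt0 t : -1 < t < 1 -> 0 < floor t.
Proof.
move=> t1; have /andP[h _] := profile_bounds t t1.
by rewrite /floor mulr_gt0// divr_gt0 ?gamma_gt0 ?Gamma1_gt0.
Qed.

Lemma floor_le t : -1 < t < 1 -> floor t <= rho.
Proof.
move=> t1; have /andP[_ h] := profile_bounds t t1.
have d0 := d_gt0; have dr := d_lt_rho; rewrite /floor half_d.
apply: (@le_trans _ _ (d / 2 * 1)); last by lra.
by rewrite ler_wpM2l//; lra.
Qed.

Lemma clip_bounds s x : -1 < s < 1 ->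
  floor s <= Num.min rho (Num.max x (floor s)) <= rho.
Proof.
by move=> s1; rewrite ge_min lexx le_min floor_le//= le_max lexx orbT.
Qed.

Lemma clip_gt0 s x : -1 < s < 1 -> 0 < Num.min rho (Num.max x (floor s)).
Proof.
move=> s1; have /andP[h _] := clip_bounds s x s1.
exact: lt_le_trans (floor_gt0 s s1) h.
Qed.

Lemma truncated_continuous (y : R -> R) : continuous y ->
  forall s, -1 < s < 1 -> {for s, continuous (fun s => truncated s (y s))}.
Proof.
move=> cy s s1.
have cm : {for s, continuous (fun s => Num.min rho (Num.max (y s) (floor s)))}.
  apply: continuous_min; first exact: cvg_cst.
  by apply: continuous_max; [exact: cy|exact: continuous_floor].
apply: (@continuous_comp _ _ _ (fun s => (s, Num.min rho (Num.max (y s) (floor s))))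
  (fun p : R * R => f p.1 p.2)).
  exact: (@cvg_pair _ _ _ (nbhs s) (nbhs s) (nbhs _) _ _ _ (fun s => s) _ (cvg_id) cm).
by apply: f_cont_at => //; exact: clip_gt0.
Qed.

Lemma truncated_continuousx s : 0 <= s < 1 -> continuous (truncated s).
Proof.
move=> /andP[s0 s1] x.
have s1' : -1 < s < 1 by apply/andP; split; lra.
have cm : {for x, continuous (fun x => Num.min rho (Num.max x (floor s)))}.
  apply: continuous_min; first exact: cvg_cst.
  by apply: continuous_max; [exact: cvg_id|exact: cvg_cst].
apply: (@continuous_comp _ _ _ (fun x => (s, Num.min rho (Num.max x (floor s))))
  (fun p : R * R => f p.1 p.2)).
  by apply: (@cvg_pair _ _ _ (nbhs x) (nbhs s) (nbhs _) _ _ _ (fun=> s) _ _ cm); exact: cvg_cst.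
by apply: f_cont_at => //; exact: clip_gt0.
Qed.

(** [f t rho >= gamma rho > 0] forces this through [f_bound]. *)
Lemma q_gt0 t : -1 < t < 1 -> 0 < q t.
Proof.
move=> t1.
have h1 : 0 < f t rho by rewrite (lt_le_trans (gamma_gt0 rho rho_gt0))// f_ge// rho_gt0 lexx.
have h2 := f_bound t rho t1 rho_gt0.
rewrite gtr0_norm// in h2.
have uv : 0 < u rho + v rho by rewrite ltr_wpDr.
by rewrite -(pmulr_lgt0 _ uv) (lt_le_trans h1).
Qed.

Lemma f_le t x y : -1 < t < 1 -> 0 < y -> y <= x -> x <= rho -> f t x <= q t * (u y + v rho).
Proof.
move=> t1 y0 yx xr; have x0 := lt_le_trans y0 yx.
apply: le_trans (ler_norm _) _; apply: le_trans (f_bound t x t1 x0) _.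
rewrite ler_wpM2l ?(ltW (q_gt0 t t1))// lerD//; first exact: u_decr.
by apply: v_incr => //; exact: ltW.
Qed.

Lemma truncated_bounds s x : 0 <= s < 1 -> gamma rho <= truncated s x <= dominant s.
Proof.
move=> /andP[s0 s1]; have s1' : -1 < s < 1 by apply/andP; split; lra.
have /andP[c1 c2] := clip_bounds s x s1'; have c0 := clip_gt0 s x s1'.
rewrite /truncated f_ge ?c0//=.
by apply: f_le => //; exact: floor_gt0.
Qed.

Notation O := (`]-1, 1[%classic : set R).

Lemma integrable_ge0_continuous (h : R -> R) :
  (forall t, -1 < t < 1 -> {for t, continuous h}) ->
  (forall t, -1 < t < 1 -> 0 <= h t) ->
  (\int[leb]_(t in O) (h t)%:E < +oo)%E -> leb.-integrable O (EFin \o h).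
Proof.
move=> ch h0 hoo; apply/integrableP; split.
  apply/measurable_EFinP; apply: open_continuous_measurable_fun; first exact: interval_open.
  by move=> t; rewrite inE/= in_itv/= => t1; exact: ch.
rewrite [X in (X < _)%E](_ : _ = \int[leb]_(t in O) (h t)%:E)%E//.
by apply: eq_integral => t; rewrite inE/= in_itv/= => t1; rewrite /= ger0_norm// h0.
Qed.

Lemma weight_cont t : -1 < t < 1 -> {for t, continuous (fun t => (1 - `|t|) `^ p)}.
Proof.
move=> t1; apply: (@continuous_comp _ _ _ (fun t => 1 - `|t|) (fun y => y `^ p)).
  by apply: cvgB; [exact: cvg_cst|exact: norm_continuous].
by apply: continuous_powR_gt0; rewrite subr_gt0 ltr_norml.
Qed.

Lemma integrable_weight_q : leb.-integrable O (EFin \o (fun t => (1 - `|t|) `^ p * q t)).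
Proof.
apply: integrable_ge0_continuous => //.
- by move=> t t1; apply: cvgM; [exact: weight_cont|exact: q_cont_at].
- by move=> t t1; rewrite mulr_ge0 ?powR_ge0// ltW// q_gt0.
Qed.

Lemma u_profile_cont (c t : R) : 0 < c -> -1 < t < 1 ->
  {for t, continuous (fun t => u (c * (1 - `|t| `^ mu)))}.
Proof.
move=> c0 t1; apply: (@continuous_comp _ _ _ (fun t => c * (1 - `|t| `^ mu)) u).
  apply: cvgM; first exact: cvg_cst.
  by apply: cvgB; [exact: cvg_cst|exact: continuous_norm_powR].
by apply: u_cont_at; have /andP[h _] := profile_bounds t t1; rewrite mulr_gt0.
Qed.

Lemma u_profile_ge (c t : R) : 0 < c -> c <= rho -> -1 < t < 1 ->
  u rho <= u (c * (1 - `|t| `^ mu)).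
Proof.
move=> c0 cr t1; have /andP[h1 h2] := profile_bounds t t1.
by apply: u_decr; [rewrite mulr_gt0|rewrite (le_trans _ cr)// ler_piMr// ltW].
Qed.

Lemma integrable_weight_qu (c : R) : 0 < c -> c <= rho ->
  leb.-integrable O (EFin \o (fun t => (1 - `|t|) `^ p * q t * u (c * (1 - `|t| `^ mu)))).
Proof.
move=> c0 cr; apply: integrable_ge0_continuous.
- move=> t t1; apply: cvgM; last exact: u_profile_cont.
  by apply: cvgM; [exact: weight_cont|exact: q_cont_at].
- move=> t t1; rewrite !mulr_ge0 ?powR_ge0// ?(ltW (q_gt0 _ _))//.
  by rewrite (le_trans (ltW u_rho))// u_profile_ge.
- exact: qu_int.
Qed.

Lemma half_d_gt0 : 0 < gamma rho / Gamma (mu + 1).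
Proof. by rewrite divr_gt0 ?gamma_gt0 ?Gamma1_gt0. Qed.

Lemma half_d_le : gamma rho / Gamma (mu + 1) <= rho.
Proof. by have := d_gt0; have := d_lt_rho; rewrite half_d; lra. Qed.

Lemma integrable_dominant :
  leb.-integrable D (EFin \o (fun s => (1 - s) `^ p * dominant s)).
Proof.
have DO : D `<=` O by apply: subset_itvr; rewrite bnd_simp ltrN10.
pose F1 t := (1 - `|t|) `^ p * q t * u (gamma rho / Gamma (mu + 1) * (1 - `|t| `^ mu)).
pose F2 t := (1 - `|t|) `^ p * q t.
apply: (@eq_integrable _ _ _ leb D _
  ((EFin \o F1) \+ (fun t => (F2 t)%:E * (v rho)%:E))%E); first exact: measurable_itv.
- move=> s; rewrite inE/= in_itv/= => /andP[s0 s1].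
  rewrite /= -EFinM -EFinD; congr EFin; rewrite /F1 /F2 /dominant /floor ger0_norm//; ring.
- apply: integrableD; first exact: measurable_itv.
    by apply: integrableS (integrable_weight_qu _ half_d_gt0 half_d_le).
  apply: integrableZr; first exact: measurable_itv.
  by apply: integrableS integrable_weight_q.
Qed.

Definition mass t : R := (1 - `|t|) `^ p * q t * u (d * (1 - `|t| `^ mu)).

Lemma mass_cont t : -1 < t < 1 -> {for t, continuous mass}.
Proof.
move=> t1; apply: cvgM; last by apply: u_profile_cont => //; exact: d_gt0.
by apply: cvgM; [exact: weight_cont|exact: q_cont_at].
Qed.

Lemma integrable_mass : leb.-integrable O (EFin \o mass).
Proof. by apply: integrable_weight_qu; [exact: d_gt0|exact/ltW/d_lt_rho]. Qed.

Lemma mass_ge0 t : -1 < t < 1 -> 0 <= mass t.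
Proof.
move=> t1; rewrite !mulr_ge0 ?powR_ge0// ?(ltW (q_gt0 _ _))//.
by rewrite (le_trans (ltW u_rho))// u_profile_ge ?d_gt0// ltW// d_lt_rho.
Qed.

Lemma chiE : chi mu q u gamma rho = \int[leb]_(t in O) mass t.
Proof.
apply: eq_Rintegral => t _; rewrite /mass; congr (_ * u _).
by rewrite /level mulrAC.
Qed.

(** The substitution [s -> - s] turns the left side into the integral of [mass] over [[-T, T]]; this
    folding is the source of the 2 in [2 G]. *)
Lemma mass_sym_le (T : R) : 0 <= T < 1 ->
  \int[leb]_(s in `[0, T]) (mass s + mass (- s)) <= chi mu q u gamma rho.
Proof.
move=> /andP[T0 T1].
have cm : {within `[- T, T], continuous mass}.
  apply: continuous_in_subspaceT => x; rewrite inE/= in_itv/= => /andP[xT Tx].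
  by apply: mass_cont; apply/andP; split; lra.
have im : leb.-integrable `[- T, T] (EFin \o mass).
  by apply: continuous_compact_integrable => //; exact: segment_compact.
have im1 : leb.-integrable `[0, T] (EFin \o mass).
  apply: integrableS im; [exact: measurable_itv|exact: measurable_itv|].
  by apply: subset_itvr; rewrite bnd_simp; lra.
have im2 : leb.-integrable `[0, T] (EFin \o (fun s => mass (- s))).
  apply: continuous_compact_integrable; first exact: segment_compact.
  apply: continuous_in_subspaceT => x; rewrite inE/= in_itv/= => /andP[xT Tx].
  apply: (@continuous_comp _ _ _ (fun x => - x) mass); first exact: opp_continuous.
  by apply: mass_cont; apply/andP; split; lra.
rewrite RintegralD//.
have -> : \int[leb]_(s in `[0, T]) mass (- s) = \int[leb]_(s in `[- T, 0]) mass s.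
  have := @integration_by_substitution_oppr R mass 0 T T0; rewrite oppr0 /Rintegral => -> //.
  apply: continuous_subspaceW cm.
  by apply: subset_itvl; rewrite bnd_simp.
rewrite -[X in X + _]Rintegral_itv_obnd_cbnd; last first.
  apply: integrableS im1; [exact: measurable_itv|exact: measurable_itv|].
  by apply: subset_itvr; rewrite bnd_simp.
rewrite -(Rintegral_itvB im) ?bnd_simp//; last by lra.
rewrite subrK chiE /Rintegral fine_le//.
- exact: integrable_fin_num.
- by apply: integrable_fin_num integrable_mass; exact: measurable_itv.
apply: ge0_subset_integral => //.
- by apply/measurable_EFinP; case/integrableP : integrable_mass => /measurable_EFinP.
- by move=> t; rewrite /= in_itv/= => t1; rewrite lee_fin mass_ge0.
- by apply: subset_itv; rewrite bnd_simp; lra.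
Qed.

Notation Y n m := (tonelli p G truncated n m).
Notation E n m := (delayed truncated n.+1%:R^-1 (Y n m)).

Local Ltac tonelli_side := first
  [ exact: p_gt0 | exact: G_gt0 | exact: (gamma_gt0 _ rho_gt0) | exact: truncated_bounds
  | exact: integrable_dominant | exact: truncated_continuous | exact: truncated_continuousx ].

Lemma E_admissible n m : admissible dominant (E n m).
Proof. by apply: (@admissible_tonelli _ p dominant G (gamma rho) truncated); tonelli_side. Qed.

Lemma Y_E n m t : Y n m t = m - volterra p (E n m) t / G.
Proof. exact: tonelliE. Qed.

Lemma Y_continuous n m : continuous (Y n m).
Proof. by apply: (@continuous_tonelli_sol _ p dominant G (gamma rho) truncated); tonelli_side. Qed.

Lemma Y_nonincreasing n m t t' : t <= t' -> Y n m t' <= Y n m t.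
Proof.
by move=> tt'; apply: (@tonelli_nonincreasing _ p dominant G (gamma rho) truncated) => //; tonelli_side.
Qed.

Lemma Y_le0 n m t : t <= 0 -> Y n m t = m.
Proof. by move=> t0; apply: (@tonelli_le0 _ p G truncated). Qed.

Lemma Y_increment n m t : 0 <= t <= 1 ->
  gamma rho * (p + 1)^-1 * (1 - t `^ (p + 1)) / G <= Y n m t - Y n m 1.
Proof.
by move=> t01; apply: (@tonelli_increment _ p dominant G (gamma rho) truncated) => //; tonelli_side.
Qed.

Lemma E_continuous n m s : -1 < s < 1 -> {for s, continuous (E n m)}.
Proof.
move=> s1; apply: (@continuous_delayed _ truncated) => //; last exact: Y_continuous.
exact: truncated_continuous.
Qed.

Lemma E_ge n m s : 0 <= s < 1 -> gamma rho <= E n m s.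
Proof. by move=> s01; have /andP[] := truncated_bounds s (Y n m (s - n.+1%:R^-1)) s01. Qed.

Definition wgt s : R := (1 - s) `^ p / G.

Lemma wgt_cont s : s < 1 -> {for s, continuous wgt}.
Proof.
move=> s1; apply: cvgM; last exact: cvg_cst.
apply: (@continuous_comp _ _ _ (fun s => 1 - s) (fun y => y `^ p)).
  by apply: cvgB; [exact: cvg_cst|exact: cvg_id].
by apply: continuous_powR_gt0; rewrite subr_gt0.
Qed.

(** [t - s <= t (1 - s)] for [s <= t <= 1], so the kernel at time [t] is at most [t ^ p] times the
    kernel at time 1. *)
Lemma Y_growth n t : 0 <= t < 1 ->
  rho - Y n rho t <= t `^ p * \int[leb]_(s in `[0, t]) (wgt s * E n rho s).
Proof.
move=> t01; have /andP[t0 t1] := t01.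
have G0 := G_gt0.
have cw : leb.-integrable `[0, t] (EFin \o (fun s => wgt s * E n rho s)).
  apply: continuous_compact_integrable; first exact: segment_compact.
  apply: continuous_in_subspaceT => s; rewrite inE/= in_itv/= => /andP[s0 st].
  apply: cvgM; first by apply: wgt_cont; lra.
  by apply: E_continuous; apply/andP; split; lra.
rewrite Y_E opprB addrC subrK ler_pdivrMr//.
have E1 : volterra p (E n rho) t = \int[leb]_(s in `[0, t]) (vker p t s * E n rho s).
  have Dt : D `&` [set` `[0, t]] = [set` `[0, t]].
    by apply: setIidr => s /=; rewrite !in_itv/= => /andP[-> /le_lt_trans]; apply.
  rewrite -[in RHS]Dt Rintegral_mkcondr; apply: eq_Rintegral => s; rewrite inE/= in_itv/= => /andP[s0 s1].
  rewrite patchE mem_setE in_itv/= s0/=; case: ifPn => //; rewrite -ltNge => ts.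
  by rewrite /vker kern_le0 ?mul0r// subr_le0 (le_trans _ (ltW ts))// ge_min lexx.
rewrite E1 mulrAC -RintegralZl//.
have iv : leb.-integrable `[0, t] (EFin \o (fun s => vker p t s * E n rho s)).
  apply: integrableS (integrable_volterra _ _ p_gt0 integrable_dominant _ t (E_admissible n rho)).
  - exact: measurable_itv.
  - exact: measurable_itv.
  - by apply: subset_itvl; rewrite bnd_simp.
apply: le_Rintegral => //.
  rewrite (_ : _ \o _ = fun s => ((t `^ p * G)%:E * (EFin \o (fun s => (wgt s * E n rho s)%R)) s)%E)//.
  by apply: integrableZl.
move=> s; rewrite /= in_itv/= => /andP[s0 st].
have e0 : 0 <= E n rho s.
  by apply: le_trans (E_ge n rho s _); [apply/ltW/gamma_gt0|apply/andP; split; lra].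
rewrite mulrA ler_wpM2r//.
rewrite (_ : t `^ p * G * wgt s = t `^ p * (1 - s) `^ p); last first.
  by rewrite /wgt; field; rewrite gt_eqF.
rewrite /vker min_l; last by lra.
have [->|nst] := eqVneq s t.
  by rewrite subrr kern_le0// mulr_ge0 ?powR_ge0.
have st' : s < t by rewrite lt_neqAle nst.
rewrite kernE ?subr_gt0// addrK -powRM//; last by lra.
apply: ge0_ler_powR; rewrite ?nnegrE; [exact/ltW/p_gt0|lra| |nra].
by apply: mulr_ge0; lra.
Qed.

(** [q] need not be even, but evenness of [f] gives the bound with [q (- s)] as well, and the two
    are averaged. As [u b / u rho >= 1], this ratio can be factored out of the [v rho] term too. *)
Lemma E_le n s (z : R) : 0 <= s < 1 -> 0 <= z < 1 -> d * (1 - `|z| `^ mu) <= Y n rho s ->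
  E n rho s <= (q s + q (- s)) / 2 * (u rho + v rho) * (u (d * (1 - `|z| `^ mu)) / u rho).
Proof.
move=> /andP[s0 s1] /andP[z0 z1] yb.
have s1' : -1 < s < 1 by apply/andP; split; lra.
have s1'' : -1 < - s < 1 by apply/andP; split; lra.
have z1' : -1 < z < 1 by apply/andP; split; lra.
have /andP[b1 b2] := profile_bounds z z1'.
set b := d * _ in yb *.
have b0 : 0 < b by rewrite mulr_gt0// d_gt0.
have br : b <= rho.
  by rewrite (le_trans _ (ltW d_lt_rho))// ler_piMr// ltW// d_gt0.
have yh : Y n rho s <= Y n rho (s - n.+1%:R^-1).
  by apply: Y_nonincreasing; rewrite lerBlDr lerDl.
rewrite /delayed /truncated; set X := Num.min rho _.
have bX : b <= X by rewrite le_min br/= le_max (le_trans yb yh).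
have Xr : X <= rho by rewrite ge_min lexx.
have h1 := f_le s X b s1' b0 bX Xr.
have h2 := f_le (- s) X b s1'' b0 bX Xr.
rewrite -f_even ?(lt_le_trans b0)// in h2.
have q1 := q_gt0 s s1'; have q2 := q_gt0 (- s) s1''.
have ub : u rho <= u b by exact: u_decr.
have h3 : u b + v rho <= (u rho + v rho) * (u b / u rho).
  rewrite mulrA ler_pdivlMr// mulrDl [leRHS]mulrDl.
  by rewrite [u b * _]mulrC lerD2l ler_wpM2l.
rewrite -mulrA.
apply: le_trans (ler_average _ _ _ _ h1 h2) _.
by apply: ler_wpM2l h3; rewrite divr_ge0// addr_ge0// ltW.
Qed.

Definition uratio s : R := u (d * (1 - `|s| `^ mu)) / u rho.

Definition sym_dom s : R := (q s + q (- s)) / 2 * (u rho + v rho).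

Lemma uratio_cont s : -1 < s < 1 -> {for s, continuous uratio}.
Proof.
move=> s1; apply: cvgM; last exact: cvg_cst.
by apply: u_profile_cont => //; exact: d_gt0.
Qed.

Lemma uratio_ge1 s : -1 < s < 1 -> 1 <= uratio s.
Proof.
move=> s1; rewrite /uratio ler_pdivlMr// mul1r.
by rewrite u_profile_ge ?d_gt0// ltW// d_lt_rho.
Qed.

Lemma sym_dom_ge s : -1 < s < 1 -> gamma rho <= sym_dom s.
Proof.
move=> s1.
have s1' : -1 < - s < 1 by move: s1 => /andP[? ?]; apply/andP; split; lra.
have H t : -1 < t < 1 -> gamma rho <= q t * (u rho + v rho).
  move=> t1; apply: (@le_trans _ _ (f t rho)); first by rewrite f_ge// rho_gt0 lexx.
  exact: f_le.
have h1 := H s s1; have h2 := H (- s) s1'; rewrite /sym_dom; lra.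
Qed.

Lemma sym_dom_cont s : -1 < s < 1 -> {for s, continuous sym_dom}.
Proof.
move=> s1; apply: cvgM; last exact: cvg_cst.
apply: cvgM; last exact: cvg_cst.
apply: cvgD; first exact: q_cont_at.
apply: (@continuous_comp _ _ _ (fun s => - s) q); first exact: opp_continuous.
by apply: q_cont_at; move: s1 => /andP[? ?]; apply/andP; split; lra.
Qed.

Lemma chi_bound : chi mu q u gamma rho * (1 + v rho / u rho) / (2 * G) < 5 / 6 * rho.
Proof.
have G35 : 3 / 5 <= G by apply: Gamma_ge => //; exact: ltW.
have c0 : 0 <= chi mu q u gamma rho.
  rewrite chiE; apply: Rintegral_ge0 => t; rewrite /= in_itv/=; exact: mass_ge0.
have uv : 0 < 1 + v rho / u rho by rewrite ltr_wpDr// divr_ge0// ltW.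
set B := chi mu q u gamma rho * (1 + v rho / u rho).
have B0 : 0 <= B by rewrite mulr_ge0// ltW.
have Br : B < rho.
  (* If [B = 0], the quotient is 0 by convention and the hypothesis would read [0 > 1]. *)
  have := chi_lt; rewrite -/B; have [->|Bn0] := eqVneq B 0; first by rewrite invr0 mulr0 ltNge ler01.
  by rewrite ltr_pdivlMr ?mul1r// lt_neqAle eq_sym Bn0.
rewrite ltr_pdivrMr; last by rewrite mulr_gt0// G_gt0.
by have : 5 / 6 * rho * (2 * G) >= rho; [have := rho_gt0; nra|lra].
Qed.

Lemma mass_integral_le (T : R) : 0 <= T < 1 ->
  \int[leb]_(s in `[0, T]) (wgt s * (sym_dom s * uratio s)) <=
  chi mu q u gamma rho * (1 + v rho / u rho) / (2 * G).
Proof.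
move=> T01; have /andP[T0 T1] := T01.
have uv : 0 < 1 + v rho / u rho by rewrite ltr_wpDr// divr_ge0// ltW.
pose k := (1 + v rho / u rho) / (2 * G).
have k0 : 0 < k by rewrite divr_gt0// mulr_gt0// G_gt0.
have cs : leb.-integrable `[0, T] (EFin \o (fun s => mass s + mass (- s))).
  apply: continuous_compact_integrable; first exact: segment_compact.
  apply: continuous_in_subspaceT => x; rewrite inE/= in_itv/= => /andP[x0 xT].
  apply: cvgD; first by apply: mass_cont; apply/andP; split; lra.
  apply: (@continuous_comp _ _ _ (fun x => - x) mass); first exact: opp_continuous.
  by apply: mass_cont; apply/andP; split; lra.
have -> : \int[leb]_(s in `[0, T]) (wgt s * (sym_dom s * uratio s)) =
    \int[leb]_(s in `[0, T]) (k * (mass s + mass (- s))).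
  apply: eq_Rintegral => s; rewrite inE/= in_itv/= => /andP[s0 sT].
  rewrite /mass normrN ger0_norm// /wgt /sym_dom /uratio ger0_norm// /k.
  by field; rewrite !gt_eqF// G_gt0.
rewrite RintegralZl// -mulrA mulrC ler_wpM2r ?(ltW k0)//.
exact: mass_sym_le.
Qed.

Lemma tonelli_init_gt0 n : 0 < Y n rho 1.
Proof.
rewrite ltNge; apply/negP => Y1.
have d0 := d_gt0; have dr := d_lt_rho; have G0 := G_gt0.
have m1 : (-1 : R) < 0 by rewrite ltrN10.
have [F [F0 DF FE]] : exists H : R -> R, [/\ H 0 = 0,
    (forall t, -1 / 2 < t < 1 -> is_derive t 1 H (wgt t * E n rho t)) &
    forall t, 0 <= t < 1 -> H t = \int[leb]_(s in `[0, t]) (wgt s * E n rho s)].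
  apply: primitive_exists => // s /andP[s0 s1].
  by apply: cvgM; [exact: wgt_cont|apply: E_continuous; apply/andP; split].
have [C [C0 DC CE]] : exists H : R -> R, [/\ H 0 = 0,
    (forall t, -1 / 2 < t < 1 -> is_derive t 1 H (wgt t * (sym_dom t * uratio t))) &
    forall t, 0 <= t < 1 -> H t = \int[leb]_(s in `[0, t]) (wgt s * (sym_dom s * uratio s))].
  apply: primitive_exists => // s s11; have /andP[s0 s1] := s11.
  by apply: cvgM; [exact: wgt_cont|apply: cvgM; [exact: sym_dom_cont|exact: uratio_cont]].
(* [primitive_exists] halves the left end; [lo / 2] then lies strictly below the initial phase
   [(d - rho) / d]. *)
pose lo := 2 * ((d - rho) / d - 1).
have lo0 : lo < 0.
  have : (d - rho) / d < 0 by rewrite pmulr_llt0 ?invr_gt0// subr_lt0.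
  by rewrite /lo; lra.
have lod : lo / 2 * d < d - rho.
  rewrite (_ : lo / 2 * d = (d - rho) - d); first by lra.
  by rewrite /lo [2 * _]mulrC mulfK// mulrBl divfK ?gt_eqF// mul1r.
have [Th [_ DTh _]] : exists H : R -> R, [/\ H 0 = 0,
    (forall t, lo / 2 < t < 1 -> is_derive t 1 H ((uratio (Num.max t 0))^-1)) &
    forall t, 0 <= t < 1 -> H t = \int[leb]_(s in `[0, t]) (uratio (Num.max s 0))^-1].
  apply: primitive_exists => // s /andP[_ s1].
  have s01 : -1 < Num.max s 0 < 1.
    by rewrite lt_max m1 orbT gt_max s1 ltr01.
  apply: cvgV; first by rewrite gt_eqF// (lt_le_trans ltr01)// uratio_ge1.
  apply: (@continuous_comp _ _ _ (fun s => Num.max s 0) uratio); last exact: uratio_cont.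
  by apply: continuous_max; [exact: cvg_id|exact: cvg_cst].
have in01 t : 0 <= t < 1 -> -1 / 2 < t < 1 /\ -1 < t < 1.
  by move=> /andP[t0 t1]; split; apply/andP; split; lra.
pose ph := phase F d rho.
have FY t : 0 <= t < 1 -> rho - Y n rho t <= t `^ p * F t.
  by move=> t01; rewrite FE//; exact: Y_growth.
have F_ge0 t : 0 <= t < 1 -> 0 <= F t.
  move=> t01; have /andP[t0 t1] := t01; rewrite FE//; apply: Rintegral_ge0 => s.
  rewrite /= in_itv/= => /andP[s0 st].
  apply: mulr_ge0; first by rewrite divr_ge0 ?powR_ge0// ltW.
  by apply: le_trans (E_ge n rho s _); [apply/ltW/gamma_gt0|apply/andP; split; lra].
have Fph t : F t = rho - d + d * ph t.
  by rewrite /ph /phase mulrCA mulfV ?gt_eqF// mulr1 addrC subrK.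
(* With [z] the larger of [ph t] and [t], [rho - y t <= z ^ p F t = z ^ p (rho - d + d ph t) <= rho
   - d + d z ^ mu], by [z ^ p <= 1] and [ph t <= z]. This is [y t >= d (1 - z ^ mu)]. *)
have phi_le t : 0 <= t < 1 -> ph t < 1 ->
    E n rho t <= sym_dom t * uratio (Num.max (ph t) t).
  move=> t01 pt; have /andP[t0 t1] := t01.
  set z := Num.max _ _.
  have tz : t <= z by rewrite le_max lexx orbT.
  have pz : ph t <= z by rewrite le_max lexx.
  have z1 : z < 1 by rewrite gt_max pt.
  have z0 : 0 <= z by exact: le_trans tz.
  apply: E_le => //; first by rewrite z0.
  rewrite ger0_norm//.
  have h1 := FY t t01.
  have tp : t `^ p <= z `^ p by apply: ge0_ler_powR; rewrite ?nnegrE// ltW// p_gt0.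
  have zp1 : z `^ p <= 1.
    rewrite [leRHS](_ : _ = 1 `^ p); last by rewrite powR1.
    by apply: ge0_ler_powR; rewrite ?nnegrE//; [exact/ltW/p_gt0|exact: ltW].
  have h2 : t `^ p * F t <= z `^ p * F t by rewrite ler_wpM2r// F_ge0.
  have h3 : z `^ p * F t <= (rho - d) + d * z `^ mu.
    rewrite -(mulr_powRB1 z0 mu_gt0) Fph mulrDr; apply: lerD.
      by rewrite ler_piMl// subr_ge0 ltW.
    rewrite mulrCA ler_wpM2l ?(ltW d0)// [leRHS]mulrC ler_wpM2l ?powR_ge0//.
  rewrite mulrBr mulr1; exact: ler_of_growth h1 h2 h3.
have Cle : forall eta : R, 0 < eta < 1 ->
    rho - d + d * (5 / 6 - 7 / 3 * eta) <= chi mu q u gamma rho * (1 + v rho / u rho) / (2 * G).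
  move=> eta e01; have /andP[e0 e1] := e01.
  (* [F] and [C] live on [[0, 1)] only, so the phase is stopped at [1 - eta]. This level is reached
     before 1 since, by continuity and [Y n rho 1 <= 0], the solution is below [d eta] near 1. *)
  have [t1 t1b pht1] : exists2 t1 : R, 0 <= t1 < 1 & ph t1 = 1 - eta.
    have de : Y n rho 1 < d * eta by apply: le_lt_trans Y1 _; rewrite mulr_gt0.
    have H : \forall t \near (1 : R)^'-, Y n rho t < d * eta.
      exact: (cvgr_lt _ (cvg_at_left_filter (Y_continuous n rho 1)) _ de).
    have [T0 /andP[T00 T01] YT0] : exists2 T0 : R, 0 < T0 < 1 & Y n rho T0 < d * eta.
      near (1 : R)^'- => T0; exists T0; first by apply/andP; split.
      by near: T0.
    have T0b : 0 <= T0 < 1 by rewrite ltW.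
    have phT0 : 1 - eta <= ph T0.
      rewrite /ph /phase ler_pdivlMr//.
      have h1 := FY T0 T0b.
      have h2 : T0 `^ p * F T0 <= F T0.
        rewrite ler_piMl ?F_ge0// [leRHS](_ : _ = 1 `^ p); last by rewrite powR1.
        by apply: ge0_ler_powR; rewrite ?nnegrE//; [exact/ltW/p_gt0|exact: ltW|exact: ltW].
      exact: ler_of_level h1 h2 YT0.
    have ph0 : ph 0 <= 1 - eta.
      rewrite /ph /phase F0 sub0r; apply: (@le_trans _ _ 0); last by rewrite subr_ge0 ltW.
      by rewrite pmulr_lle0 ?invr_gt0// oppr_le0 subr_ge0 ltW.
    have cph : {within `[0, T0], continuous ph}.
      apply: continuous_in_subspaceT => t; rewrite inE/= in_itv/= => /andP[t0 tT].
      apply: cvgM; last exact: cvg_cst.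
      apply: cvgB; last exact: cvg_cst.
      have t01 : 0 <= t < 1 by rewrite t0 (le_lt_trans tT).
      exact: is_derive_continuous _ _ _ (DF t (in01 t t01).1).
    have vb : Num.min (ph 0) (ph T0) <= 1 - eta <= Num.max (ph 0) (ph T0).
      by rewrite ge_min ph0/= le_max phT0 orbT.
    have [t1 t1b pt1] := @IVT R ph 0 T0 (1 - eta) (ltW T00) cph vb.
    exists t1 => //; move: t1b; rewrite in_itv/= => /andP[-> /le_lt_trans]; exact.
  have [T T01 CT] : exists2 T : R, 0 <= T < 1 &
      rho - d + barrier mu d (1 - eta) - d * eta <= C T.
    apply: (@a_priori R wgt (E n rho) sym_dom uratio (rate mu) F C (barrier mu d)
      Th d rho (gamma rho) (lo / 2) d0 _ lod _ _ _ _ _ _ _ _ _ DTh F0 C0 (barrier0 mu d) phi_le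
      eta t1 e01 t1b pht1).
    - by rewrite pmulr_llt0 ?invr_gt0.
    - by move=> t _; rewrite divr_ge0 ?powR_ge0// ltW.
    - by move=> t t01; apply: le_trans (E_ge n rho t t01); apply/ltW/gamma_gt0.
    - by move=> t t01; rewrite rate_ge0 rate_le1.
    - move=> t t01; rewrite sqr_rate// /wgt /level GammaDr.
      by field; rewrite !gt_eqF ?mu_gt0.
    - by move=> t t01; apply: sym_dom_ge; case: (in01 t t01).
    - by move=> t t01; apply: uratio_ge1; case: (in01 t t01).
    - by move=> t t01; apply: DF; case: (in01 t t01).
    - by move=> t t01; apply: DC; case: (in01 t t01).
    - by move=> t t01; exact: is_derive_barrier.
  have h1 := barrier_ge mu d mu_gt1 mu_le2 d0 eta e01.
  have h2 := mass_integral_le T T01; rewrite -CE// in h2.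
  apply: le_trans h2; apply: le_trans CT.
  by rewrite -[leRHS]addrA lerD2l.
by have := chi_bound; rewrite ltNge (ler_of_all_eta _ _ _ d0 dr Cle).
Unshelve. all: end_near. Qed.

(** * Shooting and passage to the limit *)

Lemma shot_exists n : exists2 m, 0 <= m <= rho & Y n m 1 = 0.
Proof.
apply: (@tonelli_shooting _ p dominant G (gamma rho) truncated) => //; try by tonelli_side.
exact: tonelli_init_gt0.
Qed.

Definition shot n : R := s2val (cid2 (shot_exists n)).

Notation X_ n := (Y n (shot n)).

Lemma shot_bounds n : 0 <= shot n <= rho.
Proof. exact: (s2valP (cid2 (shot_exists n))). Qed.

Lemma X_1 n : X_ n 1 = 0.
Proof. exact: (s2valP' (cid2 (shot_exists n))). Qed.

Lemma X_bounds n t : 0 <= X_ n t <= rho.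
Proof.
have /andP[m0 mr] := shot_bounds n.
apply/andP; split; last first.
  have [t0|t0] := leP t 0; first by rewrite Y_le0.
  by rewrite (le_trans _ mr)// -[leRHS](Y_le0 n _ 0 (lexx 0)) Y_nonincreasing// ltW.
have [t1|t1] := leP t 1; first by rewrite -(X_1 n) Y_nonincreasing.
by rewrite Y_E -volterra_min (min_r (ltW t1)) -Y_E X_1.
Qed.

Lemma X_floor n t : 0 <= t <= 1 -> floor t <= X_ n t.
Proof.
move=> t01; have := Y_increment n (shot n) t t01.
rewrite X_1 subr0 subrK; apply: le_trans.
case/andP: t01 => t0 _; rewrite /floor ger0_norm// GammaDr.
rewrite le_eqVlt; apply/orP; left; apply/eqP.
by field; rewrite !gt_eqF ?mu_gt0 ?G_gt0.
Qed.

Lemma dominant_bounded (T : R) : 0 <= T < 1 ->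
  exists2 M, 0 <= M & forall s, 0 <= s <= T -> dominant s <= M.
Proof.
move=> /andP[T0 T1].
have cd : {within `[0, T], continuous dominant}.
  apply: continuous_in_subspaceT => s; rewrite inE/= in_itv/= => /andP[s0 sT].
  have s1 : -1 < s < 1 by apply/andP; split; lra.
  apply: cvgM; first exact: q_cont_at.
  apply: cvgD; last exact: cvg_cst.
  by apply: u_profile_cont => //; exact: half_d_gt0.
have [c /[!in_itv]/= /andP[c0 cT] cmax] := @EVT_max R dominant 0 T T0 cd.
exists (dominant c); last by move=> s s0T; apply: cmax; rewrite in_itv.
have c01 : 0 <= c < 1 by rewrite c0 (le_lt_trans cT).
have /andP[h1 h2] := truncated_bounds c 0 c01.
by apply: le_trans h2; apply: le_trans h1; exact/ltW/gamma_gt0.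
Qed.

Lemma Y_modulus (T : R) : 0 <= T < 1 -> exists2 K, 0 <= K &
  forall n m t t', 0 <= t' -> t' <= t -> t <= T ->
    Y n m t' - Y n m t <= K * (t `^ mu - t' `^ mu).
Proof.
move=> T01; have /andP[T0 T1] := T01; have [M M0 dM] := dominant_bounded T T01.
have G0 := G_gt0; have p0 := p_gt0.
exists (M * mu^-1 / G); first by rewrite divr_ge0 ?mulr_ge0 ?invr_ge0 ?(ltW mu_gt0) ?(ltW G0).
move=> n m t t' t'0 t't tT.
have eM s : 0 <= s < t -> E n m s <= M.
  move=> /andP[s0 st]; have s01 : 0 <= s < 1 by apply/andP; split; lra.
  have /andP[_ h] := truncated_bounds s (Y n m (s - n.+1%:R^-1)) s01.
  by apply: le_trans h _; apply: dM; rewrite s0 (ltW (lt_le_trans st tT)).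
have t1 : t <= 1 by rewrite (le_trans tT)// ltW.
have := volterra_modulus p dominant p0 integrable_dominant (E n m) M t t'
  (E_admissible n m) M0 eM t'0 t't t1.
rewrite !Y_E subrK.
move: (volterra p _ t) (volterra p _ t') => V V' h.
have -> : m - V' / G - (m - V / G) = (V - V') / G by ring.
by rewrite ler_pdivrMr// mulrAC divfK ?gt_eqF.
Qed.

Section limit.
Variable X : R -> R.
Hypothesis X_cluster : forall (k : nat) (g : 'I_k -> R) (N : nat) (e : R), 0 < e ->
    exists2 n, (N <= n)%N & forall i : 'I_k, `|X_ n (g i) - X (g i)| < e.

(** [K] does not depend on [n], and both values of [X] are approximated by the same [X_ n], so
    inequalities between two points survive. *)
Lemma X_modulus (T : R) : 0 <= T < 1 -> exists2 K, 0 <= K &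
  forall t t', 0 <= t' -> t' <= t -> t <= T ->
    X t <= X t' /\ X t' - X t <= K * (t `^ mu - t' `^ mu).
Proof.
move=> T01; have [K K0 HK] := Y_modulus T T01; exists K => // t t' t'0 t't tT.
apply: ler_of_approx => e e0.
have [n _ Hn] := X_cluster 2 (fun i => if i == ord0 then t' else t) 0 e e0.
exists (X_ n t'), (X_ n t); split.
- exact: (Hn ord0).
- exact: (Hn ord_max).
- exact: Y_nonincreasing.
- exact: HK.
Qed.

Lemma X_continuous_in s : 0 <= s < 1 -> forall e, 0 < e ->
  exists2 dl, 0 < dl & forall t, 0 <= t < 1 -> `|t - s| < dl -> `|X t - X s| < e.
Proof.
move=> /andP[s0 s1] e e0.
have T01 : 0 <= (1 + s) / 2 < 1 by apply/andP; split; lra.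
have [K K0 HK] := X_modulus _ T01.
have ck : {for s, continuous (fun t => K * (`|t| `^ mu))}.
  by apply: cvgM; [exact: cvg_cst|exact: continuous_norm_powR].
move: ck => /cvgrPdist_lt/(_ e e0)/nbhs_ballP[dl/= dl0 Hdl].
exists (Num.min dl ((1 - s) / 2)); first by rewrite lt_min dl0 divr_gt0// subr_gt0.
move=> t /andP[t0 t1]; rewrite lt_min => /andP[ts1 ts2].
have := Hdl t; rewrite /ball/= distrC => /(_ ts1).
rewrite (ger0_norm t0) (ger0_norm s0) -mulrBr; apply: le_lt_trans.
have tT : t <= (1 + s) / 2 by move: ts2; rewrite ltr_norml => /andP[_]; lra.
have sT : s <= (1 + s) / 2 by lra.
have [ts|st] := leP t s.
  have [h1 h2] := HK s t t0 ts sT.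
  by rewrite ger0_norm ?subr_ge0// (le_trans h2)// ler_norm.
have [h1 h2] := HK t s s0 (ltW st) tT.
by rewrite distrC ger0_norm ?subr_ge0// (le_trans h2)// -normrN -mulrN opprB ler_norm.
Qed.

Lemma grid_subsequence : exists phi : nat -> nat, forall k, (k <= phi k)%N /\
  forall i, (i <= k.+1)%N -> `|X_ (phi k) (i%:R / k.+1%:R) - X (i%:R / k.+1%:R)| < k.+1%:R^-1.
Proof.
suff H k : exists n, (k <= n)%N /\
    forall i, (i <= k.+1)%N -> `|X_ n (i%:R / k.+1%:R) - X (i%:R / k.+1%:R)| < k.+1%:R^-1.
  by have [phi Hphi] := choice H; exists phi.
have k0 : 0 < (k.+1%:R^-1 : R) by rewrite invr_gt0.
have [n kn Hn] := X_cluster k.+2 (fun i : 'I_k.+2 => (i : nat)%:R / k.+1%:R) k _ k0.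
exists n; split=> // i ik; have ik2 : (i < k.+2)%N by [].
exact: (Hn (Ordinal ik2)).
Qed.

End limit.

Lemma integral_solution : exists Z : R -> R, [/\ continuous Z, Z 1 = 0,
  (forall t, 0 <= t < 1 -> 0 < Z t <= rho) &
  forall t, Z t = Z 0 - volterra p (fun s => f s (Z s)) t / G].
Proof.
have [X HX] := cluster_selection (fun n => X_ n) rho X_bounds.
have [phi Hphi] := grid_subsequence X HX.
have cX := X_continuous_in X HX.
have Xmono k t t' : t <= t' -> X_ (phi k) t' <= X_ (phi k) t by exact: Y_nonincreasing.
have Xgrid k := (Hphi k).2.
have cvgX s (s_ : nat -> R) : 0 <= s < 1 -> (forall k, 0 <= s_ k) -> s_ @ \oo --> s ->
    (fun k => X_ (phi k) (s_ k)) @ \oo --> X s.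
  move=> s01; apply: (monotone_grid_cvg (fun k => X_ (phi k)) X s s_ Xmono Xgrid s01).
  exact: cX.
have cvgXt t : 0 <= t < 1 -> (fun k => X_ (phi k) t) @ \oo --> X t.
  by move=> /[dup] t01 /andP[t0 _]; apply: cvgX => //; exact: cvg_cst.
pose h k : R := (phi k).+1%:R^-1.
have h0 k : 0 <= h k by rewrite /h invr_ge0.
have hk k : h k <= k.+1%:R^-1.
  by rewrite lef_pV2 ?posrE// ler_nat ltnS; exact: (Hphi k).1.
have cvgh : h @ \oo --> (0 : R).
  by apply: (squeeze_cvgr _ (cvg_cst 0) cvg_harmonic); apply: nearW => k; rewrite h0 hk.
have cvgE s : D s -> (fun k => E (phi k) (shot (phi k)) s) @ \oo --> truncated s (X s).
  rewrite /= in_itv/= => s01; have /andP[s0 _] := s01.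
  have H : (fun k => X_ (phi k) (s - h k)) @ \oo --> X s.
    (* The approximations are constant for negative times, so the delayed argument can be clipped at
       0, as [cvgX] requires. *)
    rewrite (_ : (fun k => _) = fun k => X_ (phi k) (Num.max (s - h k) 0)); last first.
      apply/funext => k; have [//|/ltW sh] := leP 0 (s - h k).
      by rewrite !Y_le0.
    apply: cvgX => //; first by move=> k; rewrite le_max lexx orbT.
    have cm : {for (0 : R), continuous (fun x => Num.max (s - x) 0)}.
      apply: continuous_max; last exact: cvg_cst.
      by apply: cvgB; [exact: cvg_cst|exact: cvg_id].
    have := continuous_cvg _ cm cvgh; rewrite subr0 max_l//; exact.
  by apply: (continuous_cvg _ (truncated_continuousx s s01 (X s))); exact: H.
pose e s := truncated s (X s).
have ae : admissible dominant e.
  split.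
    apply: (measurable_fun_cvg _ cvgE) => k.
    by case: (E_admissible (phi k) (shot (phi k))).
  move=> s; rewrite /= in_itv/= => s01; have /andP[h1 h2] := truncated_bounds s (X s) s01.
  by rewrite h2 andbT (le_trans _ h1)// ltW// gamma_gt0.
have cvgV t : volterra p (E (phi k) (shot (phi k))) t @[k --> \oo] --> volterra p e t.
  apply: (volterra_cvg p dominant p_gt0 integrable_dominant) => //.
  by move=> k; exact: E_admissible.
have c00 : 0 <= (0 : R) < 1 by rewrite lexx ltr01.
have cvgm : shot (phi k) @[k --> \oo] --> X 0.
  rewrite (_ : (fun k => _) = fun k => X_ (phi k) 0); first exact: cvgXt.
  by apply/funext => k; rewrite Y_le0.
(* [X] is controlled on [[0, 1)] only. The limit of the right-hand sides defines [Z] on the whole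
   line: it is continuous, agrees with [X] on [[0, 1)], and inherits the value 0 at 1. *)
pose Z t := X 0 - volterra p e t / G.
have cvgZ t : (fun k => X_ (phi k) t) @ \oo --> Z t.
  rewrite (_ : (fun k => _) = fun k => shot (phi k) - volterra p (E (phi k) (shot (phi k))) t / G).
    by apply: cvgB => //; apply: cvgM => //; exact: cvg_cst.
  by apply/funext => k; exact: Y_E.
have ZX t : 0 <= t < 1 -> Z t = X t.
  by move=> t01; apply: cvg_unique (cvgZ t) (cvgXt t t01).
have Zb t : 0 <= t < 1 -> floor t <= Z t <= rho.
  move=> t01; have /andP[t0 t1] := t01; apply/andP; split.
    by apply: (cvgr_to_ge (cvgZ t)); apply: nearW => k; apply: X_floor; rewrite t0 ltW.
  by apply: (cvgr_to_le (cvgZ t)); apply: nearW => k; case/andP: (X_bounds (phi k) t).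
have eZ s : D s -> e s = f s (Z s).
  rewrite /= in_itv/= => s01; rewrite /e -ZX// /truncated.
  by have /andP[h1 h2] := Zb s s01; rewrite (max_l h1) (min_r h2).
exists Z; split.
- move=> t; apply: cvgB; first exact: cvg_cst.
  apply: cvgM; last exact: cvg_cst.
  exact: (volterra_continuous p dominant p_gt0 integrable_dominant).
- have X10 : (fun k => X_ (phi k) 1) = fun=> 0 by apply/funext => k; exact: X_1.
  by have := cvgZ 1; rewrite X10 => /cvg_unique; apply => //; exact: cvg_cst.
- move=> t t01; have /andP[h1 ->] := Zb t t01; rewrite andbT.
  by apply: lt_le_trans h1; apply: floor_gt0; case/andP: t01 => t0 ->; rewrite (lt_le_trans _ t0)// ltrN10.
- move=> t; rewrite (ZX 0 c00) [LHS]/Z; congr (_ - _ / _); apply: eq_Rintegral => s /set_mem Ds.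
  by rewrite eZ.
Qed.

End bvp.

(** * Regularity and Caputo derivatives *)

Section derive_in.
Context {R : realType}.
Implicit Types (D : set R) (x h : R -> R) (t d : R).

Lemma is_derive_diff_quotient h t d : is_derive t 1 h d ->
  diff_quotient h t s @[s --> t^'] --> d.
Proof.
move=> [dh <-].
have H : (fun y => y^-1 *: (h (y *: 1 + t) - h t)) @ 0^' --> 'D_1 h t := dh.
apply/cvgrPdist_lt => e e0; move/cvgrPdist_lt : H => /(_ e e0).
move=> /nbhs_ballP[/= dl dl0 H]; apply/nbhs_ballP; exists dl => //= s ts st.
have := H (s - t); rewrite /ball/= sub0r normrN distrC => /(_ ts).
rewrite subr_eq0 => /(_ st); rewrite [(_ - _) *: 1]mulr1 subrK.
by rewrite /diff_quotient [_ *: _]mulrC.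
Qed.

(** Reduces a derivative at an endpoint of [D] to the two-sided derivative of a continuation [h];
    properness of the filter makes the limit unique. *)
Lemma derive_inP D x h t d : ProperFilter (within D t^') -> D t ->
  (\forall s \near t, D s -> x s = h s) -> is_derive t 1 h d ->
  derivable_in D x t /\ derive_in D x t = d.
Proof.
move=> FF Dt xh dh.
have c : diff_quotient x t s @[s --> within D t^'] --> d.
  apply: (@cvg_trans _ (diff_quotient h t s @[s --> within D t^'])).
    apply: near_eq_cvg; have xt := nbhs_singleton xh Dt.
    have : \forall s \near t^', D s -> x s = h s by exact: cvg_within xh.
    by apply: filterS => s xs Ds; rewrite /diff_quotient xt xs.
  by apply: cvg_within_filter; exact: is_derive_diff_quotient.
by split; [apply/cvg_ex; exists d|exact: cvg_lim].
Qed.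

Lemma within_right_proper t : 0 <= t < 1 -> ProperFilter (within (`[0, 1[%classic : set R) t^').
Proof.
move=> /andP[t0 t1]; apply: Build_ProperFilter_ex => A H.
have H' : \forall s \near t^'+, 0 <= s < 1 -> A s.
  move: H => /nbhs_ballP[/= e e0 H]; apply/nbhs_ballP; exists e => //= s ts st s01.
  by apply: H => //; rewrite gt_eqF.
near (t^'+) => s; exists s; apply: (near H' s) => //.
by apply/andP; split; [rewrite (le_trans t0)//|].
Unshelve. all: end_near. Qed.

Lemma within_left_proper t : -1 < t <= 0 -> ProperFilter (within (`]-1, 0]%classic : set R) t^').
Proof.
move=> /andP[t0 t1]; apply: Build_ProperFilter_ex => A H.
have H' : \forall s \near t^'-, -1 < s <= 0 -> A s.
  move: H => /nbhs_ballP[/= e e0 H]; apply/nbhs_ballP; exists e => //= s ts st s01.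
  by apply: H => //; rewrite lt_eqF.
near (t^'-) => s; exists s; apply: (near H' s) => //.
by apply/andP; split; [|rewrite (le_trans _ t1)//].
Unshelve. all: end_near. Qed.

End derive_in.

Section caputo.
Context {R : realType}.
Notation leb := (@lebesgue_measure R).
Implicit Types (t s T : R).
Variables (mu : R) (Z phi : R -> R).
Hypotheses (mu1 : 1 < mu) (mu2 : mu <= 2).
Hypothesis cphi : forall s, -1 < s < 1 -> {for s, continuous phi}.
Hypothesis phi0 : forall s, 0 <= s < 1 -> 0 <= phi s.
Notation p := (mu - 1).
Hypothesis ZE : forall t, Z t = Z 0 - volterra p phi t / Gamma mu.

Let p0 : 0 < p. Proof. by rewrite subr_gt0. Qed.

Let pDr : p + 1 = mu. Proof. by rewrite subrK. Qed.

Let GammaE : Gamma mu = p * Gamma p.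
Proof. by rewrite -(GammaDl _ p0) addrC pDr. Qed.

(** [phi] may be unbounded near 1, whereas the Riemann-Liouville lemmas ask for a bounded continuous
    nonnegative function on the line. Up to time [T] only the values on [[0, T]] matter. *)
Definition clamped T s : R := phi (Num.min T (Num.max s 0)).

Lemma clampedE T s : 0 <= s <= T -> clamped T s = phi s.
Proof. by move=> /andP[s0 sT]; rewrite /clamped max_l// min_r. Qed.

Lemma clamp_itv T s : 0 <= T < 1 -> 0 <= Num.min T (Num.max s 0) <= T.
Proof. by move=> /andP[T0 T1]; rewrite le_min T0 le_max lexx orbT ge_min lexx. Qed.

Lemma clamped_ge0 T : 0 <= T < 1 -> forall s, 0 <= clamped T s.
Proof.
move=> T01 s; have /andP[h1 h2] := clamp_itv T s T01; case/andP: T01 => _ T1.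
by apply: phi0; rewrite h1 (le_lt_trans h2).
Qed.

Lemma clamped_continuous T : 0 <= T < 1 -> continuous (clamped T).
Proof.
move=> T01 s.
apply: (@continuous_comp _ _ _ (fun s => Num.min T (Num.max s 0)) phi).
  apply: continuous_min; first exact: cvg_cst.
  by apply: continuous_max; [exact: cvg_id|exact: cvg_cst].
have /andP[h1 h2] := clamp_itv T s T01; case/andP: T01 => _ T1.
by apply: cphi; rewrite (le_lt_trans h2)// andbT (lt_le_trans _ h1)// ltrN10.
Qed.

Lemma clamped_bounded T : 0 <= T < 1 -> exists M, forall s, clamped T s <= M.
Proof.
move=> T01; have /andP[T0 T1] := T01.
have cd : {within `[0, T], continuous phi}.
  apply: continuous_in_subspaceT => s; rewrite inE/= in_itv/= => /andP[s0 sT].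
  by apply: cphi; apply/andP; split; lra.
have [c _ cmax] := @EVT_max R phi 0 T T0 cd.
by exists (phi c) => s; apply: cmax; rewrite in_itv/= clamp_itv.
Qed.

Lemma volterra_RL T t : 0 <= T < 1 -> t <= T -> volterra p phi t = RL (clamped T) mu t.
Proof.
move=> T01 tT; have /andP[T0 T1] := T01.
rewrite /volterra /Rintegral /RL /eRL; congr fine.
rewrite -integral_itv_obnd_cbnd; last first.
  apply/measurable_EFinP; apply: measurable_funM.
    by apply: measurable_funTS; exact: measurable_kernB.
  apply: open_continuous_measurable_fun; first exact: interval_open.
  by move=> s; rewrite inE/= in_itv/= => /andP[s0 s1]; apply: cphi; apply/andP; split; lra.
rewrite integral_mkcond; apply: eq_integral => s _.
rewrite patchE mem_setE in_itv/= /vker pDr /restr_pos min_l ?(le_trans tT (ltW T1))//.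
have [s0|s0] := ltP 0 s; last by rewrite (kern_le0 1)// mul0r mulr0.
have [st|ts] := ltP s t; last by rewrite kern_le0 ?subr_le0// !mul0r; case: ifP.
rewrite (lt_trans st (le_lt_trans tT T1))/= kern1// mul1r clampedE//.
by rewrite ltW//= (le_trans (ltW st)).
Qed.

Lemma is_derive_volterra T t : 0 <= T < 1 -> t < T ->
  is_derive t 1 Z (- (RL (clamped T) p t / Gamma p)).
Proof.
move=> T01 tT; have [M gM] := clamped_bounded T T01.
have D1 := is_derive_RL _ M (clamped_continuous T T01) (clamped_ge0 T T01) gM p t p0.
rewrite pDr in D1.
have D2 : is_derive t 1 (fun s => Z 0 - (Gamma mu)^-1 * RL (clamped T) mu s)
    (- (RL (clamped T) p t / Gamma p)).
  rewrite (_ : - _ = 0 - (Gamma mu)^-1 *: (p * RL (clamped T) p t)).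
    exact: (is_deriveB (is_derive_cst (Z 0) t 1) (is_deriveZ (Gamma mu)^-1 D1)).
  rewrite sub0r GammaE; congr (- _); rewrite -[RHS]/(_ * _).
  by field; rewrite !gt_eqF// Gamma_gt0.
apply: near_eq_is_derive D2.
near=> s; rewrite (ZE s) (volterra_RL T)// 1?mulrC//.
by apply: ltW; near: s; exact: lt_nbhsl.
Unshelve. all: end_near. Qed.

Lemma derive1_volterra T t : 0 <= T < 1 -> t < T ->
  derive1 Z t = - (RL (clamped T) p t / Gamma p).
Proof. by move=> T01 tT; have [_ <-] := is_derive_volterra T t T01 tT; rewrite derive1E. Qed.

(** Negative [t] are included: [Z] is constant there and joins the right branch without a corner, so
    at 0 both one-sided derivatives of the even extension come from this one. *)
Lemma is_derive_Z t : t < 1 -> is_derive t 1 Z (derive1 Z t).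
Proof.
move=> t1; pose T := (1 + Num.max t 0) / 2.
have m1 : Num.max t 0 < 1 by rewrite gt_max t1 ltr01.
have m0 : 0 <= Num.max t 0 by rewrite le_max lexx orbT.
have mt : t <= Num.max t 0 by rewrite le_max lexx.
have T01 : 0 <= T < 1 by rewrite /T; apply/andP; split; lra.
have tT : t < T by rewrite /T; lra.
by rewrite (derive1_volterra T)//; exact: is_derive_volterra.
Qed.

Lemma continuous_derive1_Z t : t < 1 -> {for t, continuous (derive1 Z)}.
Proof.
move=> t1; pose T := (1 + Num.max t 0) / 2.
have m1 : Num.max t 0 < 1 by rewrite gt_max t1 ltr01.
have m0 : 0 <= Num.max t 0 by rewrite le_max lexx orbT.
have mt : t <= Num.max t 0 by rewrite le_max lexx.
have T01 : 0 <= T < 1 by rewrite /T; apply/andP; split; lra.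
have tT : t < T by rewrite /T; lra.
have [M gM] := clamped_bounded T T01.
have c : {for t, continuous (fun s => - (RL (clamped T) p s / Gamma p))}.
  apply: cvgN; apply: cvgM; last exact: cvg_cst.
  exact: (continuous_RL _ M (clamped_continuous T T01) (clamped_ge0 T T01) gM).
suff : derive1 Z s @[s --> t] --> derive1 Z t by [].
rewrite (derive1_volterra T)//.
apply: cvg_trans c; apply: near_eq_cvg; near=> s; rewrite (derive1_volterra T)//.
by near: s; exact: lt_nbhsl.
Unshelve. all: end_near. Qed.

Lemma derive1_Z0 : derive1 Z 0 = 0.
Proof.
have T01 : 0 <= (1 / 2 : R) < 1 by apply/andP; split; lra.
by rewrite (derive1_volterra (1 / 2)) ?divr_gt0// RL_le0// mul0r oppr0.
Qed.

Notation x := (fun t => Z `|t|).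

Lemma derive_in_right t : 0 <= t < 1 ->
  derivable_in `[0, 1[ x t /\ derive_in `[0, 1[ x t = derive1 Z t.
Proof.
move=> t01; apply: (derive_inP _ x Z t).
- exact: within_right_proper.
- by rewrite /= in_itv.
- by apply: (@nearW _ (nbhs t)) => s; rewrite /= in_itv/= => /andP[s0 _]; rewrite ger0_norm.
- by apply: is_derive_Z; case/andP: t01.
Qed.

Lemma is_derive_Z_opp t : -1 < t -> is_derive t 1 (fun s => Z (- s)) (- derive1 Z (- t)).
Proof.
move=> t1; have h : - t < 1 by rewrite ltrNl.
have DZ := is_derive_Z (- t) h.
have DN : is_derive t (1 : R) (@GRing.opp R) (- 1) by apply: is_deriveN; exact: is_derive_id.
have := is_derive1_comp DZ DN; rewrite mulrN1; exact.
Qed.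

Lemma derive_in_left t : -1 < t <= 0 ->
  derivable_in `]-1, 0] x t /\ derive_in `]-1, 0] x t = - derive1 Z (- t).
Proof.
move=> t01; apply: (derive_inP _ x (fun s => Z (- s)) t).
- exact: within_left_proper.
- by rewrite /= in_itv.
- by apply: (@nearW _ (nbhs t)) => s; rewrite /= in_itv/= => /andP[_ s0]; rewrite ler0_norm.
- by apply: is_derive_Z_opp; case/andP: t01.
Qed.

Lemma C1_right : C1_in `[0, 1[ x.
Proof.
split; first by move=> t; rewrite /= in_itv/= => /derive_in_right[].
apply: (subspace_eq_continuous (f := derive1 Z)).
  by move=> t; rewrite inE/= in_itv/= => /derive_in_right[].
apply: continuous_in_subspaceT => t; rewrite inE/= in_itv/= => /andP[_ t1].
exact: continuous_derive1_Z.
Qed.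

Lemma C1_left : C1_in `]-1, 0] x.
Proof.
split; first by move=> t; rewrite /= in_itv/= => /derive_in_left[].
apply: (subspace_eq_continuous (f := fun t => - derive1 Z (- t))).
  by move=> t; rewrite inE/= in_itv/= => /derive_in_left[].
apply: continuous_in_subspaceT => t; rewrite inE/= in_itv/= => /andP[t1 _].
apply: cvgN; apply: (@continuous_comp _ _ _ (fun t => - t) (derive1 Z)).
  exact: opp_continuous.
by apply: continuous_derive1_Z; rewrite ltrNl.
Qed.

(** Up to sign the integrand of the Caputo primitive: the second factor is [- Z'] for [s < T], and
    the kernel has order [2 - mu]. *)
Definition rate_kern T t s : R := kern (2 - mu) (t - s) * (RL (clamped T) p s / Gamma p).

Lemma rate_kern_ge0 T t s : 0 <= T < 1 -> 0 <= rate_kern T t s.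
Proof.
move=> T01; rewrite /rate_kern mulr_ge0 ?kern_ge0// divr_ge0 ?RL_ge0//; last exact/ltW/Gamma_gt0.
exact: clamped_ge0.
Qed.

Lemma measurable_rate_kern T t : 0 <= T < 1 -> measurable_fun setT (rate_kern T t).
Proof.
move=> T01; have [M gM] := clamped_bounded T T01.
apply: measurable_funM; first exact: measurable_kernB.
apply: measurable_funM => //; apply: continuous_measurable_fun.
exact: (continuous_RL _ M (clamped_continuous T T01) (clamped_ge0 T T01) gM).
Qed.

(** The orders add up to [p + (2 - mu) = 1]. For [mu = 2] the kernel would have order 0 and not be
    integrable at 0, hence the separate branch in the Caputo primitives. *)
Lemma integral_rate_kern T t : mu < 2 -> 0 <= T < 1 ->
  (\int[leb]_s (rate_kern T t s)%:E = (Gamma (2 - mu) * RL (clamped T) 1 t)%:E)%E.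
Proof.
move=> mu2' T01; have [M gM] := clamped_bounded T T01.
have b0 : 0 < 2 - mu by rewrite subr_gt0.
have Gp := Gamma_gt0 p p0.
have E := integral_RL _ M (clamped_continuous T T01) (clamped_ge0 T T01) gM p (2 - mu) t p0 b0.
have -> : Gamma (2 - mu) * RL (clamped T) 1 t =
    (Gamma p)^-1 * (Gamma (2 - mu) * Gamma p / Gamma (p + (2 - mu)) * RL (clamped T) (p + (2 - mu)) t).
  have -> : p + (2 - mu) = 1 by ring.
  by rewrite Gamma1; field; rewrite gt_eqF.
rewrite EFinM -E -ge0_integralZl//; last 3 first.
- apply/measurable_EFinP; apply: measurable_funM; first exact: measurable_kernB.
  apply: continuous_measurable_fun.
  exact: (continuous_RL _ M (clamped_continuous T T01) (clamped_ge0 T T01) gM).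
- by move=> s _; rewrite lee_fin mulr_ge0 ?kern_ge0 ?RL_ge0//; exact: clamped_ge0.
- by rewrite lee_fin invr_ge0 ltW.
apply: eq_integral => s _; rewrite -EFinM; congr EFin.
by rewrite /rate_kern mulrA mulrC.
Qed.

Lemma rate_kernE T t s : mu < 2 -> 0 <= T < 1 -> 0 <= s <= t -> t < T ->
  rate_kern T t s = - derive1 Z s / (t - s) `^ p.
Proof.
move=> m2 T01 /andP[s0 st] tT.
rewrite (derive1_volterra T) ?(le_lt_trans st)// opprK [RHS]mulrC; congr (_ * _).
(* At [s = t] both sides are 0: the left by the cut in [kern], the right by division by
   [0 ^ p = 0]. *)
have := st; rewrite -subr_ge0 le_eqVlt => /orP[/eqP<-|y0].
  by rewrite kern_le0// powR0 ?invr0// gt_eqF.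
by rewrite kernE// -powRN; congr (_ `^ _); ring.
Qed.

Lemma rate_kern_out T t s : 0 <= T < 1 -> ~~ (0 <= s <= t) -> rate_kern T t s = 0.
Proof.
move=> T01; rewrite negb_and -!ltNge /rate_kern => /orP[s0|ts].
  by rewrite RL_le0 ?(ltW s0)// mul0r mulr0.
by rewrite kern_le0 ?mul0r// subr_le0 ltW.
Qed.

Lemma caputo_left_primitiveE T t : 0 <= T < 1 -> 0 <= t < T ->
  caputo_left_primitive mu x t = - RL (clamped T) 1 t.
Proof.
move=> T01 /andP[t0 tT]; have /andP[T0 T1] := T01.
have Dx s : 0 <= s < 1 -> derive_in `[0, 1[ x s = derive1 Z s by move=> /derive_in_right[].
have t01 : 0 <= t < 1 by rewrite t0 (lt_trans tT).
rewrite /caputo_left_primitive Dx// Dx ?lexx ?ltr01// derive1_Z0 subr0.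
case: eqVneq => [m2|mn2].
  have E1 : p = 1 by rewrite m2; ring.
  by rewrite (derive1_volterra T)// E1 Gamma1 divr1.
have m2 : mu < 2 by rewrite lt_neqAle mn2.
rewrite [X in _ * X](_ : _ = - (Gamma (2 - mu) * RL (clamped T) 1 t)).
  by rewrite mulrN mulKf// gt_eqF// Gamma_gt0// subr_gt0.
rewrite -[_ * RL _ _ _]/(fine _%:E) -(integral_rate_kern T t)//.
rewrite /Rintegral -fineN -integral_ge0N; last by move=> s _; rewrite lee_fin rate_kern_ge0.
congr fine; rewrite integral_mkcond; apply: eq_integral => s _.
rewrite patchE mem_setE in_itv/=; case: ifPn => [st|st]; last by rewrite rate_kern_out ?oppr0.
rewrite Dx; last by case/andP: st => -> st; rewrite (le_lt_trans st (lt_trans tT T1)).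
by rewrite subr0 rate_kernE// -mulNr opprK.
Qed.

Lemma caputo_right_primitiveE T t : 0 <= T < 1 -> - T < t <= 0 ->
  caputo_right_primitive mu x t = RL (clamped T) 1 (- t).
Proof.
move=> T01 /andP[tT t0]; have /andP[T0 T1] := T01.
have Dx s : -1 < s <= 0 -> derive_in `]-1, 0] x s = - derive1 Z (- s) by move=> /derive_in_left[].
have T1' : -1 < - T by rewrite ltrN2.
have t01 : -1 < t <= 0 by rewrite t0 (lt_trans _ tT).
have c0 : -1 < (0 : R) <= 0 by rewrite lexx ltrN10.
rewrite /caputo_right_primitive Dx// (Dx 0)// oppr0 derive1_Z0 oppr0 subr0 sqrrN expr1n.
case: eqVneq => [m2|mn2].
  have E1 : p = 1 by rewrite m2; ring.
  by rewrite (derive1_volterra T) 1?ltrNl// E1 Gamma1 divr1 opprK mul1r.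
have m2 : mu < 2 by rewrite lt_neqAle mn2.
rewrite [X in _ * X](_ : _ = Gamma (2 - mu) * RL (clamped T) 1 (- t)).
  by rewrite mul1r mulKf// gt_eqF// Gamma_gt0// subr_gt0.
rewrite -[RHS]/(fine _%:E) -(integral_rate_kern T (- t))//.
rewrite ge0_integral_opp; last 2 first.
- by apply/measurable_EFinP; exact: measurable_rate_kern.
- by move=> s; rewrite lee_fin rate_kern_ge0.
rewrite /Rintegral; congr fine; rewrite integral_mkcond; apply: eq_integral => s _.
rewrite patchE mem_setE in_itv/=; case: ifPn => [st|st]; last first.
  by rewrite rate_kern_out// oppr_ge0 lerN2 andbC.
have /andP[ts s0] := st.
rewrite Dx ?s0 ?andbT ?(lt_le_trans _ ts)//; last by case/andP: t01.
rewrite subr0 rate_kernE//; last 2 first.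
- by rewrite oppr_ge0 lerN2 s0.
- by rewrite ltrNl.
by rewrite opprK [- t + s]addrC.
Qed.

Lemma caputo_left_solution t : 0 <= t < 1 ->
  caputo_left_exists mu x t /\ caputo_left mu x t = - phi t.
Proof.
move=> t01; have /andP[t0 t1] := t01.
pose T := (1 + t) / 2.
have T01 : 0 <= T < 1 by rewrite /T; apply/andP; split; lra.
have tT : t < T by rewrite /T; lra.
have [M gM] := clamped_bounded T T01.
have [H [DH HE]] := RL1_primitive _ (clamped_continuous T T01).
have tN : -1 < t by rewrite (lt_le_trans _ t0)// ltrN10.
have DN : is_derive t 1 (fun s => - H s) (- phi t).
  by rewrite -(clampedE T) ?t0 ?ltW//; apply: is_deriveN; exact: DH.
rewrite /caputo_left_exists /caputo_left.
have xh : \forall s \near t, (`[0, 1[%classic : set R) s -> caputo_left_primitive mu x s = - H s.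
  near=> s; rewrite /= in_itv/= => /andP[s0 _].
  rewrite (caputo_left_primitiveE T)// ?HE// s0/=.
  by near: s; exact: lt_nbhsl.
have Dt : (`[0, 1[%classic : set R) t by rewrite /= in_itv.
have [d1 d2] := derive_inP _ _ _ t _ (within_right_proper t t01) Dt xh DN.
by split; [split; [exact: C1_right|exact: d1]|exact: d2].
Unshelve. all: end_near. Qed.

(** The reflection changes the sign of the primitive and again that of its derivative, so the
    outcome is [- phi] as on the right half. *)
Lemma caputo_right_solution t : -1 < t <= 0 ->
  caputo_right_exists mu x t /\ caputo_right mu x t = - phi (- t).
Proof.
move=> t01; have /andP[t1 t0] := t01.
pose T := (1 - t) / 2.
have T01 : 0 <= T < 1 by rewrite /T; apply/andP; split; lra.
have tT : - T < t by rewrite /T; lra.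
have [M gM] := clamped_bounded T T01.
have [H [DH HE]] := RL1_primitive _ (clamped_continuous T T01).
have tN : -1 < - t by rewrite (lt_le_trans (ltrN10 R))// oppr_ge0.
have DN : is_derive t 1 (fun s => H (- s)) (- phi (- t)).
  rewrite -(clampedE T); last by rewrite oppr_ge0 t0/= lerNl ltW.
  have D1 : is_derive t (1 : R) (@GRing.opp R) (- 1) by apply: is_deriveN; exact: is_derive_id.
  by have := is_derive1_comp (DH _ tN) D1; rewrite mulrN1; exact.
rewrite /caputo_right_exists /caputo_right.
have xh : \forall s \near t, (`]-1, 0]%classic : set R) s -> caputo_right_primitive mu x s = H (- s).
  near=> s; rewrite /= in_itv/= => /andP[_ s0].
  rewrite (caputo_right_primitiveE T)// ?HE ?oppr_ge0// s0 andbT.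
  by near: s; exact: lt_nbhsr.
have Dt : (`]-1, 0]%classic : set R) t by rewrite /= in_itv.
have [d1 d2] := derive_inP _ _ _ t _ (within_left_proper t t01) Dt xh DN.
by split; [split; [exact: C1_left|exact: d1]|exact: d2].
Unshelve. all: end_near. Qed.

Lemma derive1_right_cvg0 : derive1 x s @[s --> 0^'+] --> (0 : R).
Proof.
have c : derive1 Z s @[s --> 0^'+] --> (0 : R).
  apply: cvg_at_right_filter; rewrite -[X in _ --> X]derive1_Z0.
  by apply: continuous_derive1_Z; exact: ltr01.
apply: cvg_trans c; apply: near_eq_cvg; near=> s.
have D1 : is_derive s 1 x (derive1 Z s).
  have s1 : s < 1 by [].
  apply: near_eq_is_derive (is_derive_Z s s1).
  near=> y; rewrite gtr0_norm//; near: y; exact: lt_nbhsr.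
by case: D1 => _ <-; rewrite derive1E.
Unshelve. all: end_near. Qed.

Lemma derive1_left_cvg0 : derive1 x s @[s --> 0^'-] --> (0 : R).
Proof.
have c : (- derive1 Z (- s)) @[s --> 0^'-] --> (0 : R).
  apply: cvg_at_left_filter; rewrite -[X in _ --> X]oppr0; apply: cvgN.
  rewrite -[X in _ --> X]derive1_Z0 -[X in derive1 Z X]oppr0.
  apply: (@continuous_comp _ _ _ (fun t => - t) (derive1 Z)); first exact: opp_continuous.
  by apply: continuous_derive1_Z; rewrite oppr0 ltr01.
apply: cvg_trans c; apply: near_eq_cvg; near=> s.
have D1 : is_derive s 1 x (- derive1 Z (- s)).
  have s1 : -1 < s by [].
  apply: near_eq_is_derive (is_derive_Z_opp s s1).
  near=> y; rewrite ltr0_norm//; near: y; exact: lt_nbhsl.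
by case: D1 => _ <-; rewrite derive1E.
Unshelve. all: end_near. Qed.

End caputo.

(* The hypotheses 0 < u rho and 0 <= v rho make explicit the sign convention
   under which v(rho) / u(rho) is meant. *)
Theorem theorem3p1 (R : realType) (mu : R) (f : R -> R -> R)
  (q u v gamma : R -> R) (rho : R)
  (mu_gt1 : 1 < mu) (mu_le2 : mu <= 2)
  (f_cont : {within `]-1, 1[ `*` `]0, +oo[,
               continuous (fun p : R * R => f p.1 p.2)})
  (f_even : forall x t : R, 0 < x -> -1 < t < 1 -> f t x = f (- t) x)
  (q_cont : {within `]-1, 1[, continuous q})
  (u_cont : {within `]0, +oo[, continuous u})
  (u_decr : forall x y : R, 0 < x -> x <= y -> u y <= u x)
  (v_cont : {within `[0, +oo[, continuous v})
  (v_incr : forall x y : R, 0 <= x -> x <= y -> v x <= v y)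
  (f_bound : forall t x : R, -1 < t < 1 -> 0 < x -> `|f t x| <= q t * (u x + v x))
  (q_int : (\int[lebesgue_measure]_(t in `](-1)%R, 1%R[)
              ((1 - `|t|) `^ (mu - 1) * q t)%R%:E < +oo)%E)
  (qu_int : forall c : R, 0 < c ->
     (\int[lebesgue_measure]_(t in `](-1)%R, 1%R[)
        ((1 - `|t|) `^ (mu - 1) * q t * u (c * (1 - `|t| `^ mu)))%R%:E < +oo)%E)
  (gamma_gt0 : forall r : R, 0 < r -> 0 < gamma r)
  (gamma_decr : forall r s : R, 0 < r -> r <= s -> gamma s <= gamma r)
  (rho_gt0 : 0 < rho)
  (rho_gt : rho > 2 * gamma rho / Gamma (mu + 1))
  (f_ge : forall t x : R, -1 < t < 1 -> 0 < x <= rho -> gamma rho <= f t x)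
  (u_rho : 0 < u rho) (v_rho : 0 <= v rho)
  (chi_lt : rho / (chi mu q u gamma rho * (1 + v rho / u rho)) > 1) :
  exists x : R -> R, is_symmetric_positive_solution mu f x.

Proof.
have [Z [cZ Z1 Zb ZE]] := integral_solution mu f q u v gamma rho mu_gt1 mu_le2 f_cont
  f_even q_cont u_cont u_decr v_incr f_bound q_int qu_int gamma_gt0 rho_gt0 rho_gt f_ge
  u_rho v_rho chi_lt.
(* Negative arguments matter because [phi] has to be continuous on both sides of 0; there [Z] equals
   [Z 0]. *)
have Z_gt0 s : -1 < s < 1 -> 0 < Z s.
  move=> /andP[s1 s2]; have [s0|s0] := ltP s 0.
    rewrite ZE volterra_le0 ?mul0r ?subr0; last exact: ltW.
    by have := Zb 0; rewrite lexx ltr01 => /(_ isT)/andP[].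
  by have := Zb s; rewrite s0 s2 => /(_ isT)/andP[].
pose phi s := f s (Z s).
have cphi s : -1 < s < 1 -> {for s, continuous phi}.
  move=> s1; apply: (@continuous_comp _ _ _ (fun s => (s, Z s)) (fun p : R * R => f p.1 p.2)).
    exact: (@cvg_pair _ _ _ (nbhs s) (nbhs s) (nbhs _) _ _ _ (fun s => s) _ cvg_id (cZ s)).
  by apply: f_cont_at => //; exact: Z_gt0.
have phi0 s : 0 <= s < 1 -> 0 <= phi s.
  move=> s01; apply: (@le_trans _ _ (gamma rho)); first exact/ltW/gamma_gt0.
  apply: f_ge; last exact: Zb.
  by case/andP: s01 => s0 ->; rewrite (lt_le_trans _ s0)// ltrN10.
exists (fun t => Z `|t|); split; [|split; [|split]].
- apply: continuous_subspaceT => t.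
  by apply: (@continuous_comp _ _ _ (fun t : R => `|t|) Z); [exact: norm_continuous|exact: cZ].
- split; [|split; [|split; [|split; [|split]]]].
  + move=> t t0 t1; have t01 : 0 <= t < 1 by rewrite t0.
    have [h1 h2] := caputo_left_solution mu Z phi mu_gt1 mu_le2 cphi phi0 ZE t t01.
    by split=> //; rewrite h2 ger0_norm// addNr.
  + move=> t t1 t0; have t01 : -1 < t <= 0 by rewrite t1.
    have [h1 h2] := caputo_right_solution mu Z phi mu_gt1 mu_le2 cphi phi0 ZE t t01.
    have Nt : -1 < - t < 1 by rewrite ltrN2 ltrNl t1 andbT (le_lt_trans t0).
    (* On the left half the Caputo derivative is [- f (- t) (Z (- t))]; evenness of [f] in [t]
       restores the equation at [t]. *)
    split=> //; rewrite h2 ler0_norm// /phi f_even ?opprK ?addNr//.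
    exact: Z_gt0.
  + by rewrite normr1.
  + by rewrite normrN1.
  + exact: (derive1_right_cvg0 mu Z phi mu_gt1 cphi phi0 ZE).
  + exact: (derive1_left_cvg0 mu Z phi mu_gt1 cphi phi0 ZE).
- by move=> t _; rewrite normrN.
- move=> t t1; apply: Z_gt0; rewrite ltr_norml t1 andbT.
  by rewrite (lt_le_trans (ltrN10 R)).
Qed.
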